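(* Every graph $G$ with maximum degree at most $5$ has an acyclic $(\mathcal{S}_4\cap\mathcal{D}_1)^{(5)}$-colouring, i.e. a colouring $c:V(G)\to\{1,\dots,5\}$ such that each colour class induces a forest of maximum degree at most $4$, and for every two distinct colours $i,j$ the subgraph consisting of all edges joining a vertex of colour $i$ to a vertex of colour $j$ is acyclic.
   Context: All graphs are finite and simple. Colourings are not required to be proper. $\mathcal{S}_d$ is the class of graphs with maximum degree at most $d$ and $\mathcal{D}_1$ is the class of acyclic graphs. *)

(* Defs.v *)
From mathcomp Require Import all_boot.
Set Implicit Arguments. Unset Strict Implicit. Unset Printing Implicit Defensive.

Definition simple_graph (T : finType) (e : rel T) : Prop :=
  symmetric e /\ irreflexive e.

Definition max_deg_le (T : finType) (e : rel T) (d : nat) : Prop :=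
  forall x : T, #|[set y | e x y]| <= d.

Definition acyclic (T : finType) (r : rel T) : Prop :=
  forall s : seq T, uniq s -> 2 < size s -> ~~ cycle r s.

Definition class_rel (T : finType) (e : rel T) (k : nat) (c : T -> 'I_k) (i : 'I_k) : rel T :=
  [rel x y | [&& e x y, c x == i & c y == i]].

Definition bichrom_rel (T : finType) (e : rel T) (k : nat) (c : T -> 'I_k) (i j : 'I_k) : rel T :=
  [rel x y | e x y && (((c x == i) && (c y == j)) || ((c x == j) && (c y == i)))].

Definition acyclic_SD_colouring (T : finType) (e : rel T) (d k : nat) (c : T -> 'I_k) : Prop :=
  (forall i : 'I_k, acyclic (class_rel e c i) /\ max_deg_le (class_rel e c i) d) /\
  (forall i j : 'I_k, i != j -> acyclic (bichrom_rel e c i j)).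

(* Main.v *)
Require Import Defs.
From Stdlib Require Import Classical_Prop.
From mathcomp Require Import all_boot zify.
Set Implicit Arguments. Unset Strict Implicit. Unset Printing Implicit Defensive.

(** Take a partial colouring satisfying all constraints on its coloured part which has, first, as
few uncoloured vertices ("holes") as possible and, second, as few monochromatic edges as possible.
Suppose [v] is a hole. Colouring [v] with [y] fails only if two neighbours of [v] of the same
colour [p] are joined by a path in the [p]/[y]-graph (of edges with end colours [p] and [y]), or if
it gives some vertex five neighbours of its own colour. A neighbour of [v] has at most four coloured neighbours and needs one of colour [y]
for each [y] for which it ends such a path, so these obstructions are few. Two moves exploit this.
A neighbour of [v] whose coloured neighbours have distinct colours can be recoloured freely; and if
only two neighbours of [v] are ends of [y]-obstructions, then colouring [v] with [y] and uncolouring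
one of them moves the hole. The multiplicities of the colours around [v] are treated in the order
(2,1,1,1), (3,1,1), (2,2,1), (4,1), (3,2), (5). The delicate case is (2,2,1), where the
obstructions turn out to be completely rigid: moving the hole two steps away in two different ways
gives contradictory multiplicities around a vertex whose neighbourhood is the same in both. *)

(** Colouring a hole fails through a cycle ([linkers]) or through a saturated neighbour (negation of
    [okc]). Cycles are handled by counting. Saturation by a colour occurring once around the hole is
    excluded by minimality of [mono]: moving the hole onto the saturated neighbour lowers [mono] by
    at least 8, so a slack of 7 is affordable. Recolouring a vertex with distinctly coloured
    neighbours costs at most 2 and leads to an earlier type, whence the slacks 7 for (2,1,1,1), 5
    for (3,1,1) and (2,2,1), 3 for (4,1). Moving the hole may raise [mono] without control;
    therefore these cases also accept, in place of the slack, the direct hypothesis that the other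
    colours satisfy [okc], which can be checked at the new hole. Types (3,2) and (5) are excluded
    only for colourings with minimal [mono]. *)

Lemma sum_bool (I : finType) (P b : pred I) :
  \sum_(z | P z) (b z : nat) = #|[pred z | P z && b z]|.
Proof. by rewrite -sum1_card /= big_mkcondr; apply: eq_bigr => z _; case: (b z). Qed.

Notation colour := 'I_5.

Record graph5 := Graph5 {
  vertex :> finType;
  adj : rel vertex;
  adjC : symmetric adj;
  adjxx : irreflexive adj;
  adj_deg : max_deg_le adj 5 }.

Definition colouring (G : graph5) := {ffun G -> option colour}.

(** * Partial colourings *)

Section Basics.
Variable G : graph5.
Implicit Types (c : colouring G) (v x z : G) (p q y d : colour).

Definition upd c v o : colouring G := [ffun z => if z == v then o else c z].
Definition nb c x y := [set z | adj x z & c z == Some y].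
Definition mdeg c x y := #|nb c x y|.
(* For [p = q] this is the graph induced by the colour class of [p]. *)
Definition hrel c p q : rel G :=
  [rel x z | adj x z && (((c x == Some p) && (c z == Some q)) || ((c x == Some q) && (c z == Some p)))].
Definition cyc c := forall p q, acyclic (hrel c p q).
Definition nosat c := forall x y, c x = Some y -> mdeg c x y <= 4.
Definition good c := cyc c /\ nosat c.
(* [x] and [x'] have the same colour [p], and colouring a common uncoloured neighbour with [y] would
   close a cycle through them. *)
Definition lk c y x x' :=
  if c x is Some p then (c x' == Some p) && connect (hrel c p y) x x' else false.
Definition seen c v x := [set y | [exists x', [&& x' != x, adj v x' & lk c y x x']]].
Definition dcol c x := [set y | 0 < mdeg c x y].
Definition linkers c v y := [set x | adj v x & y \in seen c v x].
(* Colouring the hole [v] with [y] does not give a neighbour five neighbours of its own colour. *)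
Definition okc c v y := [forall x in nb c v y, mdeg c x y <= 3].
Definition holes c := #|[set x | c x == None]|.
(* Twice the number of monochromatic edges. *)
Definition mono c := \sum_x (if c x is Some y then mdeg c x y else 0).

Lemma updE c v o z : upd c v o z = if z == v then o else c z.
Proof. by rewrite ffunE. Qed.

Lemma upd_same c v o : upd c v o v = o.
Proof. by rewrite updE eqxx. Qed.

Lemma upd_other c v o z : z != v -> upd c v o z = c z.
Proof. by rewrite updE => /negbTE->. Qed.

Lemma upd_upd c v o o' : upd (upd c v o) v o' = upd c v o'.
Proof. by apply/ffunP => z; rewrite !updE; case: eqP. Qed.

Lemma upd_id c v : upd c v (c v) = c.
Proof. by apply/ffunP => z; rewrite updE; case: eqP => [->|]. Qed.

Lemma adj_neq v x : adj v x -> x != v.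
Proof. by apply: contraTneq => ->; rewrite adjxx. Qed.

Lemma in_nb c x y z : (z \in nb c x y) = adj x z && (c z == Some y).
Proof. by rewrite inE. Qed.

Lemma hrelE c p q x z : hrel c p q x z =
  adj x z && (((c x == Some p) && (c z == Some q)) || ((c x == Some q) && (c z == Some p))).
Proof. by []. Qed.

Lemma hrelC c p q : hrel c p q =2 hrel c q p.
Proof. by move=> x z; rewrite !hrelE orbC. Qed.

Lemma hrel_sym c p q : symmetric (hrel c p q).
Proof. by move=> x z; rewrite !hrelE adjC orbC; congr (_ && (_ || _)); apply: andbC. Qed.

Lemma lkP c y x x' : reflect (exists p, [/\ c x = Some p, c x' = Some p & connect (hrel c p y) x x']) (lk c y x x').
Proof.
rewrite /lk; case E: (c x) => [p|]; last by constructor => -[p []].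
apply: (iffP andP) => [[/eqP E' L]|[q [[<-] E' L]]]; first by exists p.
by rewrite E'.
Qed.

Lemma lk_sym c y x x' : lk c y x x' = lk c y x' x.
Proof.
suff H u w : lk c y u w -> lk c y w u by apply/idP/idP; apply: H.
case/lkP => p [E E' L]; apply/lkP; exists p; split => //.
by rewrite sym_connect_sym //; apply: hrel_sym.
Qed.

Lemma seenP c v x y : reflect (exists x', [/\ x' != x, adj v x' & lk c y x x']) (y \in seen c v x).
Proof. by rewrite inE; apply: (iffP existsP) => -[x' /and3P]; exists x'. Qed.

Lemma in_linkers c v y x : (x \in linkers c v y) = adj v x && (y \in seen c v x).
Proof. by rewrite inE. Qed.

Lemma okcP c v y : reflect (forall x, adj v x -> c x = Some y -> mdeg c x y <= 3) (okc c v y).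
Proof.
apply: (iffP forall_inP) => H x; last by rewrite in_nb => /andP[vx /eqP E]; apply: H.
by move=> vx E; apply: H; rewrite in_nb vx E; exact: eqxx.
Qed.

(** A neighbour has at most one colour, so it is counted for at most one [y]; [B] collects
    neighbours that contribute to none of the colours in [A], typically holes. *)
Lemma sum_mdeg_set c x (A : {set colour}) (B : {set G}) :
  (forall z, z \in B -> adj x z /\ (forall y, y \in A -> c z != Some y)) ->
  \sum_(y in A) mdeg c x y + #|B| <= 5.
Proof.
move=> HB; apply: leq_trans (adj_deg x).
have sBN : B \subset [set z | adj x z] by apply/subsetP => z /HB[]; rewrite inE.
rewrite -(cardsID B [set z | adj x z]) (setIidPr sBN) addnC leq_add2l.
have -> : \sum_(y in A) mdeg c x y = \sum_(y in A) \sum_(z in [set z | adj x z] :\: B) (c z == Some y).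
  apply: eq_bigr => y yA; rewrite sum_bool /mdeg; apply: eq_card => z.
  rewrite !inE; case: (boolP (z \in B)) => zB /=; last by rewrite andbC.
  by have [_ /(_ _ yA)/negbTE->] := HB z zB; rewrite andbF.
rewrite exchange_big /= -sum1_card; apply: leq_sum => z _.
case E: (c z) => [y|]; last by rewrite big1.
have H y' : (Some y == Some y' :> option colour) = (y == y') by [].
under eq_bigr do rewrite H.
case: (boolP (y \in A)) => yA; last first.
  by rewrite big1 // => y' y'A; case: eqP => // yy; rewrite yy y'A in yA.
rewrite (bigD1 y) //= eqxx big1 // => y' /andP[_ ny].
by rewrite eq_sym (negbTE ny).
Qed.

Lemma sum_mdeg c x (s : seq colour) (B : {set G}) : uniq s ->
  (forall z, z \in B -> adj x z /\ (forall y, y \in s -> c z != Some y)) ->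
  \sum_(y <- s) mdeg c x y + #|B| <= 5.
Proof.
move=> us HB; rewrite big_uniq //=.
have -> : \sum_(y in s) mdeg c x y = \sum_(y in [set y in s]) mdeg c x y.
  by apply: eq_bigl => y; rewrite inE.
by apply: sum_mdeg_set => z /HB[? H]; split=> // y; rewrite inE; apply: H.
Qed.

Lemma card_dcol_sum c x : #|dcol c x| <= \sum_y mdeg c x y.
Proof.
rewrite -sum1_card (bigID (mem (dcol c x)) predT) /= -[X in X <= _]addn0.
by apply: leq_add => //; apply: leq_sum => y; rewrite inE.
Qed.

Lemma sum_mdeg_hole c v x : c v = None -> adj v x -> \sum_y mdeg c x y <= 4.
Proof.
move=> cv vx; have := @sum_mdeg_set c x setT [set v] _.
rewrite cards1 addn1 => H; rewrite -ltnS; apply: leq_trans (H _).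
  by rewrite ltnS; apply: eq_leq; apply: eq_bigl => y; rewrite inE.
by move=> z; rewrite inE => /eqP->; rewrite adjC cv.
Qed.

Lemma sum_mdeg_all c x : \sum_y mdeg c x y <= 5.
Proof.
have := @sum_mdeg_set c x setT set0 _.
rewrite cards0 addn0 => H; apply: leq_trans (H _) => [|z]; last by rewrite inE.
by apply: eq_leq; apply: eq_bigl => y; rewrite inE.
Qed.

Lemma card_dcol_hole c v x : c v = None -> adj v x -> #|dcol c x| <= 4.
Proof. by move=> cv vx; apply: leq_trans (card_dcol_sum c x) (sum_mdeg_hole cv vx). Qed.

(** The linking path alternates between [p] and [y], so it starts with a [y]-vertex [z]; as it ends
    in colour [p], it continues for [p != y] to a second [p]-vertex, distinct from [x] once the path
    is shortened. *)
Lemma lk_step c y x x' p : x' != x -> lk c y x x' -> c x = Some p ->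
  exists2 z, z \in nb c x y & p != y -> exists2 z2, z2 != x & z2 \in nb c z p.
Proof.
move=> nx /lkP[q [E E' /connectP[s ps lst]]] Ep.
have qp : q = p by move: E; rewrite Ep => -[].
rewrite {q}qp in E E' ps; have E'' := E'.
case/shortenP: ps lst => {}s ps us _ lst.
case: s ps us lst => [|z s] /=; first by move=> _ _ xx; rewrite xx eqxx in nx.
case/andP => /andP[xz H] ps us lst.
have cz : c z = Some y.
  case/orP: H => /andP[/eqP H1 /eqP H2] //.
  by move: H1 H2; rewrite E => -[->].
exists z; first by rewrite in_nb xz cz eqxx.
move=> npy; case: s ps us lst => [|z2 s] /=.
  by move=> _ _ xz'; move: cz; rewrite -xz' E'' => -[pp]; rewrite pp eqxx in npy.
case/andP => /andP[zz2 H2] _ us _.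
exists z2.
  by apply: contraTneq us => ->; rewrite !inE eqxx !orbT.
rewrite in_nb zz2; case/orP: H2 => /andP[/eqP H3 /eqP ->]; last by rewrite eqxx.
by move: H3; rewrite cz => -[yp]; rewrite yp eqxx in npy.
Qed.

Lemma seen_coloured c v x y : y \in seen c v x -> exists p, c x = Some p.
Proof. by case/seenP => x' [_ _ /lkP[p [E _ _]]]; exists p. Qed.

Lemma seen_dcol c v x : seen c v x \subset dcol c x.
Proof.
apply/subsetP => y /[dup]/seen_coloured[p E] /seenP[x' [nx _ L]].
have [z zn _] := lk_step nx L E.
by rewrite inE /mdeg; apply/card_gt0P; exists z.
Qed.

Lemma mdeg_le_of2 c z y x1 x2 : x1 != x2 -> adj z x1 -> adj z x2 ->
  c x1 != Some y -> c x2 != Some y -> mdeg c z y <= 3.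
Proof.
move=> n12 a1 a2 e1 e2; have := @sum_mdeg c z [:: y] [set x1; x2] isT _.
rewrite big_seq1 cards2 n12 /= => H.
have {H} : mdeg c z y + 2 <= 5 by apply: H => u; rewrite !inE => /orP[] /eqP->; split => // y'; rewrite inE => /eqP->.
lia.
Qed.

(** The only [y]-neighbour of [x] must be the first step of the linking path. Its further
    [p]-neighbour [z2] is a neighbour not coloured [y], which keeps it from being saturated when [x]
    turns [y]. *)
Lemma seen_safe c v x y p : c x = Some p -> y \in seen c v x -> p != y -> mdeg c x y = 1 ->
  forall z, z \in nb c x y -> exists2 z2, z2 != x & z2 \in nb c z p.
Proof.
move=> E /seenP[x' [nx _ L]] npy m1 z zn.
have [z' z'n /(_ npy)[z2 H1 H2]] := lk_step nx L E.
have /cards1P[w Ew] : #|nb c x y| == 1 by rewrite -/(mdeg c x y) m1.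
move: zn z'n H2; rewrite Ew !inE => /eqP-> /eqP-> H2; exists z2 => //.
by rewrite inE.
Qed.

Lemma linkers_partner c v y x p : x \in linkers c v y -> c x = Some p ->
  exists x', [/\ x' != x, x' \in nb c v p, x' \in linkers c v y & lk c y x x'].
Proof.
rewrite in_linkers => /andP[vx /seenP[x' [nx vx' L]]] E.
exists x'; split => //; case/lkP: (L) => q [E1 E2 _]; first by rewrite in_nb vx' E2 -E1 E eqxx.
rewrite in_linkers vx'; apply/seenP; exists x; split => //; first by rewrite eq_sym.
by rewrite lk_sym.
Qed.

Lemma linkers_ge2 c v y x : x \in linkers c v y -> 2 <= #|linkers c v y|.
Proof.
move=> xk; have /seen_coloured[p E] : y \in seen c v x by move: xk; rewrite in_linkers => /andP[].
have [x' [nx _ x'k _]] := linkers_partner xk E.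
by apply/card_gt1P; exists x', x.
Qed.

End Basics.

(** * Filling, moving and recolouring *)

Section Moves.
Variable G : graph5.
Implicit Types (c : colouring G) (v x z : G) (p q y d : colour).

Lemma linkers0 c v y : linkers c v y = set0 ->
  forall x x', adj v x -> adj v x' -> x' != x -> ~~ lk c y x x'.
Proof.
move=> L0 x x' vx vx' nx; apply/negP => L.
have : x \in linkers c v y by rewrite in_linkers vx; apply/seenP; exists x'.
by rewrite L0 inE.
Qed.

Lemma hrel_upd_out c v o p q x z : x != v -> z != v -> hrel (upd c v o) p q x z = hrel c p q x z.
Proof. by move=> nx nz; rewrite !hrelE !upd_other. Qed.

Lemma hrel_upd_at c v y p q x : c v = None -> hrel (upd c v (Some y)) p q v x ->
  [/\ adj v x, x != v & exists2 r, c x = Some r & hrel c p q =2 hrel c r y].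
Proof.
move=> cv; rewrite hrelE => /andP[vx]; have nx := adj_neq vx.
rewrite upd_same upd_other // => H; split => //.
case/orP: H => /andP[/eqP[<-] /eqP E]; first by exists q => // a b; rewrite hrelC.
by exists p.
Qed.

(** A new cycle passes through [v]; removing [v] leaves a path linking two neighbours of [v] of the
    same colour. *)
Lemma cyc_fill c v y : cyc c -> c v = None -> linkers c v y = set0 -> cyc (upd c v (Some y)).
Proof.
move=> cc cv L0 p q s us ss; apply/negP => cs.
case: (boolP (v \in s)) => vs; last first.
  have /negP[] := cc p q s us ss.
  apply: sub_in_cycle cs => [x z xs zs|]; last by apply/allP => x xs; exact: (xs : x \in mem s).
  by rewrite hrel_upd_out //; [apply: contraNneq vs => <-|apply: contraNneq vs => <-].
have [i s' Es] := rot_to vs.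
move: cs us ss; rewrite -(rot_cycle i) -(rot_uniq i) -(size_rot i) Es /= rcons_path.
case: s' {Es} => // x1 s' /= /andP[/andP[h1 ps] h2] /andP[vs' /andP[x1s us]] ss.
have h2' : hrel (upd c v (Some y)) p q v (last x1 s') by rewrite hrel_sym.
have [vx1 nx1 [r cr Hr]] := hrel_upd_at cv h1.
have [vx2 nx2 [r' cr' Hr']] := hrel_upd_at cv h2'.
have n12 : last x1 s' != x1.
  case: s' ss x1s {us vs' ps h2 h2' vx2 nx2 cr'} => // x2 s' _ x1s.
  by apply: contraNneq x1s => /= E; rewrite -[X in X \in _]E mem_last.
(* Both cycle edges at [v] lie in the [p]/[q]-graph and share the end [v] of colour [y], so their
   other ends agree in colour. *)
have rr : r = r'.
  move: h1 h2'; rewrite !hrelE !upd_same !upd_other // cr cr' vx1 vx2 /=.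
  by case/orP => /andP[/eqP[yp] /eqP[rq]] /orP[] /andP[/eqP[yp'] /eqP[rq']]; congruence.
have /negP[] := linkers0 L0 vx1 vx2 n12.
apply/lkP; exists r; split => //; first by rewrite rr.
apply/connectP; exists s' => //.
have nv z : z \in x1 :: s' -> z != v by move=> zs; apply: contraNneq vs' => <-.
elim: s' (x1) nv ps {h2 h2' vs' x1s us ss vx2 nx2 cr' n12} => //= z s' IH x nv /andP[xz ps].
apply/andP; split; last by apply: IH ps => w ws; apply: nv; rewrite inE ws orbT.
by rewrite -Hr -(@hrel_upd_out c v (Some y)) //; apply: nv; rewrite !inE eqxx ?orbT.
Qed.

Lemma nb_fill c v x y y' : c v = None ->
  nb (upd c v (Some y)) x y' = if adj x v && (y == y') then v |: nb c x y' else nb c x y'.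
Proof.
move=> cv; apply/setP => z; case: ifP => H; rewrite !inE updE; case: (eqVneq z v) => [->|nz] //=.
by rewrite cv andbF.
Qed.

Lemma mdeg_fill c v x y y' : c v = None ->
  mdeg (upd c v (Some y)) x y' = mdeg c x y' + (adj x v && (y == y')).
Proof.
move=> cv; rewrite /mdeg nb_fill //; case: ifP => _; last by rewrite addn0.
by rewrite cardsU1 in_nb cv andbF addnC.
Qed.

Lemma mdeg_unc c x z p y : c x = Some p ->
  mdeg c z y = mdeg (upd c x None) z y + (adj z x && (p == y)).
Proof.
move=> cx; rewrite -(@mdeg_fill _ x z p y) ?upd_same // upd_upd -cx.
by rewrite upd_id.
Qed.

Lemma mdeg_unc_le c x z y : mdeg (upd c x None) z y <= mdeg c z y.
Proof.
apply: subset_leq_card; apply/subsetP => w; rewrite !in_nb updE.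
by case: (w =P x) => //; rewrite andbF.
Qed.

Lemma mdeg_unc_self c x y : mdeg (upd c x None) x y = mdeg c x y.
Proof.
apply: eq_card => w; rewrite !in_nb updE; case: (w =P x) => // ->.
by rewrite adjxx.
Qed.

Lemma good_fill c v y : good c -> c v = None -> linkers c v y = set0 -> okc c v y ->
  mdeg c v y <= 4 -> good (upd c v (Some y)).
Proof.
move=> [cc ns] cv L0 ok mv; split; first exact: cyc_fill.
move=> x y'; rewrite updE mdeg_fill //; case: (eqVneq x v) => [->|nx] => [[<-]|cx].
  by rewrite adjxx addn0.
have := ns _ _ cx; case: (boolP (adj x v && (y == y'))) => [/andP[xv /eqP yy]|_].
  by have := okcP _ _ _ ok x; rewrite adjC xv yy => /(_ isT cx); lia.
by rewrite addn0.
Qed.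

Lemma hrel_unc c x p q : subrel (hrel (upd c x None) p q) (hrel c p q).
Proof.
move=> u w; rewrite !hrelE !updE.
by case: (u =P x) => _; case: (w =P x) => _ //=; rewrite ?andbF.
Qed.

Lemma good_unc c x : good c -> good (upd c x None).
Proof.
move=> [cc ns]; split; last first.
  move=> z y; rewrite updE; case: eqP => // _ /ns; apply: leq_trans.
  exact: mdeg_unc_le.
move=> p q s us ss; apply: contra (cc p q s us ss).
by apply: sub_cycle; apply: hrel_unc.
Qed.

Lemma lk_unc c x y u w : lk (upd c x None) y u w -> [/\ lk c y u w, u != x & w != x].
Proof.
case/lkP => p [E E' L]; split; last 2 first.
- by apply: contra_eq_neq E => ->; rewrite upd_same.
- by apply: contra_eq_neq E' => ->; rewrite upd_same.
apply/lkP; exists p; move: E E'; rewrite !updE; case: eqP => // _; case: eqP => // _ E E'.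
split => //; apply: connect_sub L => a b ab; apply: connect1; exact: (hrel_unc ab).
Qed.

Lemma seen_unc c x v z : seen (upd c x None) v z \subset seen c v z.
Proof.
apply/subsetP => y /seenP[x' [nx vx' /lk_unc[L _ _]]].
by apply/seenP; exists x'.
Qed.

Lemma linkers_unc c x v y : linkers (upd c x None) v y \subset linkers c v y :\ x.
Proof.
apply/subsetP => z; rewrite in_linkers => /andP[vz H].
rewrite in_setD1 in_linkers vz (subsetP (seen_unc _ _ _ _) _ H) !andbT.
by case/seenP: H => x' [_ _ /lk_unc[]].
Qed.

Lemma holes_fill c v y : c v = None -> holes c = (holes (upd c v (Some y))).+1.
Proof.
move=> cv; rewrite /holes (cardsD1 v) inE cv eqxx add1n; congr _.+1.
by apply: eq_card => z; rewrite !inE updE; case: eqVneq.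
Qed.

Lemma holes_unc c x p : c x = Some p -> holes (upd c x None) = (holes c).+1.
Proof. by move=> cx; rewrite (@holes_fill _ x p) ?upd_same // upd_upd -cx upd_id. Qed.

Lemma mono_fill c v y : c v = None -> mono (upd c v (Some y)) = mono c + 2 * mdeg c v y.
Proof.
move=> cv; rewrite /mono (bigD1 v) //= [in RHS](bigD1 v) //= upd_same cv add0n.
rewrite mdeg_fill // adjxx addn0 mul2n -addnn addnA [RHS]addnC; congr (_ + _).
rewrite addnC.
transitivity (\sum_(x | x != v) ((if c x is Some y0 then mdeg c x y0 else 0) + ((adj v x) && (c x == Some y)))).
  apply: eq_bigr => x nx; rewrite upd_other //; case E: (c x) => [q|]; last by rewrite andbF.
  by rewrite mdeg_fill // adjC eq_sym.
rewrite big_split /= addnC; congr (_ + _); rewrite sum_bool; apply: eq_card => x.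
by rewrite !inE; case: eqVneq => // ->; rewrite adjxx.
Qed.

Lemma mono_unc c x p : c x = Some p -> mono c = mono (upd c x None) + 2 * mdeg c x p.
Proof.
move=> cx; rewrite -(mdeg_unc_self c x p) -(@mono_fill _ x p) ?upd_same // upd_upd -cx.
by rewrite upd_id.
Qed.

(* The hole moves from [v] to [x]. *)
Definition shift c v x y := upd (upd c x None) v (Some y).

Section Shift.
Variables (c : colouring G) (v x : G) (p y : colour).
Hypotheses (cv : c v = None) (cx : c x = Some p) (vx : adj v x).

Lemma shift_nxv : x != v. Proof. exact: adj_neq vx. Qed.

Lemma unc_hole : upd c x None v = None.
Proof. by rewrite upd_other // eq_sym shift_nxv. Qed.

Lemma shift_hole : shift c v x y x = None.
Proof. by rewrite /shift upd_other ?shift_nxv // upd_same. Qed.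

Lemma shift_at : shift c v x y v = Some y. Proof. exact: upd_same. Qed.

Lemma shift_other z : z != v -> z != x -> shift c v x y z = c z.
Proof. by move=> nv nx; rewrite /shift !upd_other. Qed.

Lemma shift_mdeg z y' : mdeg (shift c v x y) z y' + (adj z x && (p == y')) =
  mdeg c z y' + (adj z v && (y == y')).
Proof. by rewrite /shift mdeg_fill ?unc_hole // (@mdeg_unc c x z p y') // addnAC. Qed.

Lemma shift_mdeg_new y' : mdeg (shift c v x y) x y' = mdeg c x y' + (y == y').
Proof. by have := shift_mdeg x y'; rewrite adjxx adjC vx addn0. Qed.

Lemma shift_holes : holes (shift c v x y) = holes c.
Proof.
have := @holes_fill (upd c x None) v y unc_hole; rewrite (holes_unc cx) => -[->] //.
Qed.

(** For [p = y] the vertex [x] is counted in [mdeg c v y] but is uncoloured when [v] receives [y];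
    the term [2 * (p == y)] corrects this. *)
Lemma shift_mono : mono (shift c v x y) + 2 * mdeg c x p + 2 * (p == y) = mono c + 2 * mdeg c v y.
Proof.
rewrite /shift mono_fill ?unc_hole // (mono_unc cx) (@mdeg_unc c x v p y) // vx /=.
lia.
Qed.

(** An obstruction has two ends, so once [x] is uncoloured a single remaining candidate cannot be
    the end of one. *)
Lemma shift_good : good c -> #|linkers c v y :\ x| <= 1 ->
  (forall z, adj v z -> c z = Some y -> z != x -> mdeg c z y <= 3) ->
  mdeg c v y <= 4 + (p == y) -> good (shift c v x y).
Proof.
move=> gc Lx ok m4; apply: good_fill; rewrite ?unc_hole //; first exact: good_unc.
- apply/eqP; rewrite -subset0; apply/subsetP => z /linkers_ge2 H.
  have := subset_leq_card (linkers_unc c x v y); lia.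
- apply/okcP => z vz; rewrite updE; case: eqVneq => // nz cz.
  by apply: leq_trans (mdeg_unc_le _ _ _ _) _; apply: ok.
- by have := @mdeg_unc c x v p y cx; rewrite vx; lia.
Qed.

(** If [p = y'], uncolouring [x] frees one of at most four places; otherwise the linking path
    provides a second neighbour not coloured [y']. *)
Lemma shift_ok y' : good c -> y' \in seen c v x -> mdeg c x y' = 1 -> y' != y ->
  okc (shift c v x y) x y'.
Proof.
move=> gc s1 m1 ny; apply/okcP => z xz cz.
have nzv : z != v by apply: contra_eq_neq cz => ->; rewrite shift_at; apply: contra_neq ny => -[].
have nzx : z != x by exact: adj_neq xz.
rewrite shift_other // in cz.
case: (eqVneq p y') => [pp|np].
  have := shift_mdeg z y'; rewrite adjC xz pp eqxx /=.
  have := gc.2 _ _ cz; have -> : (y == y') = false by rewrite eq_sym; apply/negbTE.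
  by rewrite andbF; lia.
have zn : z \in nb c x y' by rewrite in_nb xz cz eqxx.
have [z2 nz2] := seen_safe cx s1 np m1 zn.
rewrite in_nb => /andP[zz2 /eqP cz2].
have nz2v : z2 != v by apply: contra_eq_neq cz2 => ->; rewrite cv.
apply: (@mdeg_le_of2 _ _ _ _ x z2).
- by rewrite eq_sym.
- by rewrite adjC.
- exact: zz2.
- by rewrite shift_hole.
- by rewrite shift_other // cz2; apply: contra_neq np => -[].
Qed.

End Shift.

Lemma seen_unc_ok c v x p d : c x = Some p -> p != d -> mdeg c x d <= 1 ->
  (d \in seen c v x) || (d \notin dcol c x) -> okc (upd c x None) x d.
Proof.
move=> cx npd md1 H; apply/okcP => z xz; rewrite updE; case: eqVneq => // nz cz.
have zn : z \in nb c x d by rewrite in_nb xz cz eqxx.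
case/orP: H => [ds|]; last first.
  by rewrite inE lt0n negbK /mdeg cards_eq0 => /eqP E; rewrite E inE in zn.
have m1 : mdeg c x d = 1 by apply/eqP; rewrite eqn_leq md1; apply/card_gt0P; exists z.
have [z2 nz2] := seen_safe cx ds npd m1 zn.
rewrite in_nb => /andP[zz2 /eqP cz2].
apply: (@mdeg_le_of2 _ _ _ _ x z2).
- by rewrite eq_sym.
- by rewrite adjC.
- exact: zz2.
- by rewrite upd_same.
- by rewrite upd_other // cz2; apply: contra_neq npd => -[].
Qed.

Section Recolour.
Variables (c : colouring G) (v x : G) (p d : colour).
Hypothesis cx : c x = Some p.

Lemma recol_mdeg z y' : mdeg (upd c x (Some d)) z y' + (adj z x && (p == y')) =
  mdeg c z y' + (adj z x && (d == y')).
Proof.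
rewrite -(upd_upd c x None) mdeg_fill ?upd_same // (@mdeg_unc c x z p y' cx); lia.
Qed.

Lemma recol_holes : holes (upd c x (Some d)) = holes c.
Proof. by have := holes_unc cx; rewrite (@holes_fill _ x d) ?upd_same // upd_upd => -[]. Qed.

Hypothesis rb : forall y, mdeg c x y <= 1.

(** At most one monochromatic edge appears, counted from both ends; this is the price of a
    recolouring in the slack of [okQ]. *)
Lemma recol_mono : mono (upd c x (Some d)) <= mono c + 2.
Proof.
rewrite -(upd_upd c x None) mono_fill ?upd_same // mdeg_unc_self (mono_unc cx).
have := rb d; lia.
Qed.

Hypotheses (cv : c v = None) (vx : adj v x) (npd : p != d).

Lemma recol_hole : upd c x (Some d) v = None.
Proof. by rewrite upd_other // eq_sym; apply: adj_neq vx. Qed.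

Lemma rainbow_linkers y : linkers (upd c x None) x y = set0.
Proof.
apply/eqP; rewrite -subset0; apply/subsetP => z zk.
have [q cz] : exists q, upd c x None z = Some q.
  by move: zk; rewrite in_linkers => /andP[_ /seen_coloured].
have [z' [nz z'n _ _]] := linkers_partner zk cz.
have zn : z \in nb (upd c x None) x q by rewrite in_nb cz eqxx andbT; move: zk; rewrite in_linkers => /andP[].
have := rb q; rewrite -(mdeg_unc_self c x q) /mdeg leqNgt => /negP[].
by apply/card_gt1P; exists z', z.
Qed.

Lemma recol_good : good c -> (d \in seen c v x) || (d \notin dcol c x) -> good (upd c x (Some d)).
Proof.
move=> gc H; rewrite -(upd_upd c x None); apply: good_fill; rewrite ?upd_same //.
- exact: good_unc.
- exact: rainbow_linkers.
- exact: (seen_unc_ok cx npd (rb d) H).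
- by rewrite mdeg_unc_self; have := rb d; lia.
Qed.

End Recolour.
End Moves.

Lemma setI_exists (I : finType) (A B : {set I}) : #|I| < #|A| + #|B| -> exists x, (x \in A) && (x \in B).
Proof.
move=> H; have : 0 < #|A :&: B|.
  have : #|A :|: B| <= #|I| := max_card _.
  by have := cardsUI A B; lia.
by case/card_gt0P => x; rewrite inE; exists x.
Qed.

(** * At most one repeated colour around the hole *)

Section Combinatorics.
Variable G : graph5.
Implicit Types (c : colouring G) (v x z : G) (p q y d a b : colour).

(** The basis of all counting below: a blocked colour has at least two linkers, while a neighbour of
    the hole sees few colours. *)
Lemma double_count c v (X : {set G}) (B : {set colour}) : (forall x, x \in X -> adj v x) ->
  \sum_(x in X) #|seen c v x :&: B| = \sum_(y in B) #|linkers c v y :&: X|.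
Proof.
move=> HX.
transitivity (\sum_(x in X) \sum_(y in B) ((y \in seen c v x) : nat)).
  by apply: eq_bigr => x _; rewrite sum_bool; apply: eq_card => y; rewrite !inE andbC.
rewrite exchange_big /=; apply: eq_bigr => y _; rewrite sum_bool; apply: eq_card => x.
rewrite !inE; case: (boolP (x \in X)) => xX; last by rewrite !andbF.
by rewrite HX ?andbT.
Qed.

Lemma sum_dcol c x (A : {set colour}) : \sum_(y in A) mdeg c x y + #|dcol c x :\: A| <= \sum_y mdeg c x y.
Proof.
rewrite (bigID (mem A) predT) /= leq_add2l -sum1_card.
rewrite [X in _ <= X](bigID (mem (dcol c x))) /= -[X in X <= _]addn0; apply: leq_add => //.
rewrite (eq_bigl (fun y => (y \notin A) && (y \in dcol c x))); last by move=> y; rewrite inE andbC.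
by apply: leq_sum => y /andP[_]; rewrite inE.
Qed.

(** At most four neighbours of [x] are coloured, and each colour present other than [y] takes one of
    them. *)
Lemma mdeg_dcol c v x y : c v = None -> adj v x -> y \in dcol c x -> mdeg c x y + #|dcol c x| <= 5.
Proof.
move=> cv vx yD; have := sum_dcol c x [set y]; rewrite big_set1 (cardsD1 y (dcol c x)) yD.
have := sum_mdeg_hole cv vx; lia.
Qed.

Lemma rainbow_card c v x : c v = None -> adj v x -> 4 <= #|dcol c x| -> forall y, mdeg c x y <= 1.
Proof.
move=> cv vx H y; case: (posnP (mdeg c x y)) => [->//|m0].
have := mdeg_dcol cv vx (_ : y \in dcol c x); rewrite inE => /(_ m0); lia.
Qed.

Lemma absent_card c v : #|[set y | mdeg c v y == 0]| = 5 - #|dcol c v|.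
Proof.
have := cardsC (dcol c v); rewrite card_ord => H.
suff -> : [set y | mdeg c v y == 0] = ~: dcol c v by lia.
by apply/setP => y; rewrite !inE -leqNgt leqn0.
Qed.

(** Saturation and obstructions compete for the same four coloured neighbours: a vertex saturated by
    [a] has none left for another colour. *)
Lemma full_seen c v x a y : c v = None -> adj v x -> 4 <= mdeg c x a -> y \in seen c v x -> y = a.
Proof.
move=> cv vx m4 /(subsetP (seen_dcol c v x)) yD; apply/eqP/negPn/negP => nya.
have aD : a \in dcol c x by rewrite inE; lia.
have := mdeg_dcol cv vx aD; rewrite (cardsD1 y) yD (cardsD1 a) in_setD1 eq_sym nya aD; lia.
Qed.

(** The ends of an obstruction come in pairs of equal colour, and only [a] may be repeated. *)
Lemma linkers_class c v a y : (forall p, p != a -> mdeg c v p <= 1) -> linkers c v y \subset nb c v a.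
Proof.
move=> H; apply/subsetP => x xk.
have [p cx] : exists p, c x = Some p by move: xk; rewrite in_linkers => /andP[_ /seen_coloured].
have [x' [nx x'n _ _]] := linkers_partner xk cx.
have xn : x \in nb c v p by rewrite in_nb cx eqxx andbT; move: xk; rewrite in_linkers => /andP[].
case: (eqVneq p a) => [<-//|/H]; rewrite leqNgt => /negP[]; apply/card_gt1P; by exists x', x.
Qed.

Lemma linkers_card c v y : linkers c v y != set0 -> 2 <= #|linkers c v y|.
Proof. by case/set0Pn => x /linkers_ge2. Qed.

Lemma nb_adj c v a x : x \in nb c v a -> adj v x. Proof. by rewrite in_nb => /andP[]. Qed.
Lemma nb_col c v a x : x \in nb c v a -> c x = Some a. Proof. by rewrite in_nb => /andP[_ /eqP]. Qed.

Lemma seen_linkers c v y x : x \in linkers c v y -> y \in seen c v x.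
Proof. by rewrite in_linkers => /andP[]. Qed.

(** The same two vertices are the ends for each of the four colours other than [a]. They have no
    room to see a fifth colour, nor to be saturated by [a]. *)
Lemma pair_unblocked c v a : c v = None -> mdeg c v a <= 2 -> (forall p, p != a -> mdeg c v p <= 1) ->
  (forall y, y != a -> linkers c v y != set0) -> linkers c v a != set0 \/ ~~ okc c v a -> False.
Proof.
move=> cv ma m1 H Ha.
have E y : linkers c v y != set0 -> linkers c v y = nb c v a.
  move=> /linkers_card k2; apply/eqP; rewrite eqEcard (linkers_class _ m1) /=.
  by apply: leq_trans k2; apply: ma.
have S x y : x \in nb c v a -> y != a -> y \in seen c v x.
  by move=> xn nya; apply: seen_linkers; rewrite E // H.
have [y0 ny0] : exists y0 : colour, y0 != a.
  by case: (eqVneq ord0 a) => [<-|]; [exists ord_max|exists ord0].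
have [x xn] : exists x, x \in nb c v a by case/set0Pn: (H _ ny0) => x; rewrite E ?H //; exists x.
have [Ha'|[u [vu cu m4]]] : linkers c v a != set0 \/ exists u, [/\ adj v u, c u = Some a & 4 <= mdeg c u a].
- case: Ha => [|/forall_inPn]; first by left.
  by case=> u un; rewrite -ltnNge => m4; right; exists u; split => //; [apply: nb_adj un|apply: nb_col un].
- have := card_dcol_hole cv (nb_adj xn); rewrite leqNgt => /negP[].
  rewrite -[X in X <= _](card_ord 5) -cardsT; apply: subset_leq_card; apply/subsetP => y _.
  apply: (subsetP (seen_dcol c v x)); case: (eqVneq y a) => [->|]; last exact: S.
  by apply: seen_linkers; rewrite E.
have := full_seen cv vu m4 (S u _ _ ny0); rewrite in_nb vu cu eqxx => /(_ isT) yy.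
by rewrite yy eqxx in ny0.
Qed.

Lemma triple_blocked c v a : c v = None -> mdeg c v a = 3 -> (forall p, p != a -> mdeg c v p <= 1) ->
  (forall y, y != a -> linkers c v y != set0) -> linkers c v a != set0 \/ ~~ okc c v a ->
  exists2 x, x \in nb c v a & 4 <= #|seen c v x|.
Proof.
move=> cv ma m1 H Ha.
have [Ha'|[u un m4]] : linkers c v a != set0 \/ exists2 u, u \in nb c v a & 4 <= mdeg c u a.
  case: Ha => [|/forall_inPn]; first by left.
  by case=> u un; rewrite -ltnNge => m4; right; exists u.
(* Five colours with two linkers each give ten incidences; three vertices seeing at most three
   colours allow only nine. *)
- apply/exists_inP; case: (boolP [exists x in _, _]) => // /exists_inPn Hn.
  have E := @double_count c v (nb c v a) setT (@nb_adj c v a).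
  have L : \sum_(x in nb c v a) #|seen c v x :&: setT| <= \sum_(x in nb c v a) 3.
    by apply: leq_sum => x /Hn; rewrite setIT -ltnNge.
  have R : \sum_(y in [set: colour]) 2 <= \sum_(y in [set: colour]) #|linkers c v y :&: nb c v a|.
    apply: leq_sum => y _; rewrite (setIidPl (linkers_class _ m1)); apply: linkers_card.
    by case: (eqVneq y a) => [->//|/H].
  rewrite -E in R; have := leq_trans R L.
  by rewrite !sum_nat_const cardsT card_ord -/(mdeg c v a) ma.
(* The saturated [u] sees at most [a], so the other two vertices are the ends for all four remaining
   colours. *)
have E y : y != a -> linkers c v y = nb c v a :\ u.
  move=> nya; apply/eqP; rewrite eqEcard; apply/andP; split; last first.
    by apply: leq_trans (linkers_card (H _ nya)); have := ma; rewrite /mdeg (cardsD1 u) un; lia.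
  apply/subsetP => x xk; rewrite in_setD1 (subsetP (linkers_class _ m1) _ xk) andbT.
  apply: contra_neq nya => xu; rewrite xu in xk; exact: full_seen cv (nb_adj un) m4 (seen_linkers xk).
have [x xn] : exists x, x \in nb c v a :\ u.
  by apply/card_gt0P; have := ma; rewrite /mdeg (cardsD1 u) un; lia.
exists x; first by move: xn; rewrite in_setD1 => /andP[].
have c4 : #|~: [set a]| = 4 by rewrite cardsC1 card_ord.
apply: leq_trans (eq_leq (esym c4)) _; apply: subset_leq_card; apply/subsetP => y; rewrite in_setC1 => nya.
by have := @seen_linkers c v y x; rewrite E // => /(_ xn).
Qed.

End Combinatorics.

Section Optimal.
Variables (G : graph5) (h M0 : nat).
Definition optimal := (forall c : colouring G, good c -> h <= holes c) /\
  (forall c : colouring G, good c -> holes c = h -> M0 <= mono c).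
Definition crit (c : colouring G) v := [/\ good c, c v = None & holes c = h].
Hypothesis opt : optimal.
Implicit Types (c : colouring G) (v x z : G) (p q y d a b : colour) (s : seq colour).

Lemma crit_block c v y : crit c v -> mdeg c v y <= 4 -> linkers c v y != set0 \/ ~~ okc c v y.
Proof.
move=> [gc cv hc] m4; case: eqP => L0; last by left.
right; apply/negP => ok; have := opt.1 _ (good_fill gc cv L0 ok m4).
by have := holes_fill y cv; lia.
Qed.

Lemma crit_shift c v x p y : crit c v -> c x = Some p -> adj v x ->
  #|linkers c v y :\ x| <= 1 ->
  (forall z, adj v z -> c z = Some y -> z != x -> mdeg c z y <= 3) ->
  mdeg c v y <= 4 + (p == y) -> crit (shift c v x y) x.
Proof.
move=> [gc cv hc] cx vx L ok m; split; [exact: (shift_good cv cx)|exact: shift_hole|].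
by rewrite (shift_holes y cv cx).
Qed.

(* Otherwise the [y]-coloured neighbour [u] has four neighbours of colour [y]; moving the hole to [u]
   loses these four edges, so [mono] drops by 8. *)
Lemma single_linked c v y : crit c v -> mdeg c v y <= 1 -> okc c v y \/ mono c <= M0 + 7 ->
  linkers c v y != set0.
Proof.
move=> cr m1 ok; have [gc cv hc] := cr.
case: (crit_block (y := y) cr); rewrite ?(leq_trans m1) // => /forall_inPn[u un]; rewrite -ltnNge => m4.
case: eqP => // L0.
case: ok => [/okcP/(_ u (nb_adj un) (nb_col un))|mo]; first by lia.
have cu := nb_col un.
have cr' : crit (shift c v u y) u.
  apply: (crit_shift cr cu (nb_adj un)).
  - by rewrite L0 set0D cards0.
  - move=> z vz cz nz; move: m1; rewrite leqNgt => /negP[]; apply/card_gt1P.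
    by exists z, u; rewrite in_nb vz cz eqxx.
  - by have := m1; lia.
have [gc' _ hc'] := cr'; have := opt.2 _ gc' hc'.
have := shift_mono y cv cu (nb_adj un); rewrite eqxx; lia.
Qed.

Lemma crit_recol c v x p d : crit c v -> c x = Some p -> adj v x -> p != d ->
  (forall y, mdeg c x y <= 1) -> (d \in seen c v x) || (d \notin dcol c x) ->
  crit (upd c x (Some d)) v.
Proof.
move=> [gc cv hc] cx vx npd rb H; split; [exact: (recol_good cx rb vx npd gc H)|exact: recol_hole|].
by rewrite (recol_holes d cx).
Qed.

(* The second alternative says that [mono] is close enough to its minimum for [single_linked]. *)
Definition okQ c v s k := (forall y, y \notin s -> okc c v y) \/ mono c <= M0 + k.

(** Only counts of [d] can grow, and the only neighbour of [v] coloured [d] afterwards is [x], which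
    has at most one such neighbour. *)
Lemma recol_okc c v x p d y : c v = None -> c x = Some p -> adj v x -> p != d ->
  (forall y, mdeg c x y <= 1) -> mdeg c v d = 0 -> okc c v y -> okc (upd c x (Some d)) v y.
Proof.
move=> cv cx vx npd rb md ok; apply/okcP => z vz cz.
have := recol_mdeg d cx z y; case: (eqVneq z x) cz => [->|nzx].
  by rewrite upd_same => -[<-]; rewrite adjxx /=; have := rb d; lia.
rewrite upd_other // => cz; have := okcP _ _ _ ok z vz cz.
case: (eqVneq d y) => [dy|]; last by rewrite andbF; lia.
by have : z \in nb c v d; [rewrite in_nb vz cz dy eqxx|move/eqP: md; rewrite cards_eq0 => /eqP->; rewrite inE].
Qed.

Lemma pair_absurd c v a : crit c v -> mdeg c v a <= 2 -> (forall p, p != a -> mdeg c v p <= 1) ->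
  okQ c v [:: a] 7 -> False.
Proof.
move=> cr ma m1 Q; have [_ cv _] := cr; apply: (pair_unblocked cv ma m1).
  move=> y nya; apply: (single_linked cr); first exact: m1.
  by case: Q => [H|]; [left; apply: H; rewrite inE|right].
by apply: (crit_block cr); apply: leq_trans ma _.
Qed.

(** An [a]-neighbour seeing four colours has distinctly coloured neighbours. One of the at least two
    colours absent around [v] is among those seen, and recolouring with it reduces the triple to a
    pair. *)
Lemma triple_absurd c v a : crit c v -> mdeg c v a = 3 -> (forall p, p != a -> mdeg c v p <= 1) ->
  okQ c v [:: a] 5 -> False.
Proof.
move=> cr ma m1 Q; have [gc cv hc] := cr.
have [||x xn s4] := triple_blocked cv ma m1.
- move=> y nya; apply: (single_linked cr); first exact: m1.
  by case: Q => [H|]; [left; apply: H; rewrite inE|right; lia].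
- by apply: (crit_block cr); rewrite ma.
have vx := nb_adj xn; have cx := nb_col xn.
have rb := rainbow_card cv vx (leq_trans s4 (subset_leq_card (seen_dcol c v x))).
have [d /andP[ds d0]] : exists d, (d \in seen c v x) && (d \in [set y | mdeg c v y == 0]).
  apply: setI_exists; rewrite card_ord absent_card.
  have := sum_dcol c v [set a]; rewrite big_set1 (cardsD1 a (dcol c v)) inE ma.
  have := sum_mdeg_all c v; lia.
rewrite inE in d0; move/eqP in d0.
have nad : a != d by apply: contra_eq_neq ma => ->; rewrite d0.
have cr' : crit (upd c x (Some d)) v by apply: (crit_recol cr cx); rewrite ?ds.
have md y := recol_mdeg d cx v y; rewrite vx /= in md.
apply: (@pair_absurd _ _ a cr').
- by have := md a; rewrite eqxx ma [d == a]eq_sym (negbTE nad); lia.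
- move=> q nq; have := md q; rewrite [a == q]eq_sym (negbTE nq) addn0 => ->.
  by case: eqVneq => [<-|_]; [rewrite d0|rewrite addn0; apply: m1].
case: Q => [H|mo]; [left => y ny|right].
- by apply: (recol_okc cv cx) => //; apply: H.
- by have := recol_mono d cx rb; lia.
Qed.

End Optimal.

(** * Two colours appearing twice *)

Section Type3.
Variables (G : graph5) (h M0 : nat).
Hypothesis opt : optimal G h M0.
Implicit Types (c : colouring G) (v x z : G) (p q y d a b : colour) (s : seq colour).
Local Notation crit := (@crit G h).
Local Notation okQ := (@okQ G M0).

Definition two_pairs c v a b := [/\ a != b, mdeg c v a = 2, mdeg c v b = 2 &
  forall p, p != a -> p != b -> mdeg c v p <= 1].

Lemma two_pairs_sym c v a b : two_pairs c v a b -> two_pairs c v b a.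
Proof. by case=> nab ma mb m1; split=> // [|p nb na]; [rewrite eq_sym|apply: m1]. Qed.

Lemma okQ_sym c v a b k : okQ c v [:: a; b] k -> okQ c v [:: b; a] k.
Proof.
case=> [H|]; [left => y|by right].
by rewrite !inE orbC => ny; apply: H; rewrite !inE.
Qed.

Lemma nb_pair c v a x z u : mdeg c v a = 2 -> x \in nb c v a -> z \in nb c v a -> u \in nb c v a ->
  z != x -> u != x -> u = z.
Proof.
move=> m2 xn zn un nzx nux.
have /cards1P[w Ew] : #|nb c v a :\ x| == 1 by move: m2; rewrite /mdeg (cardsD1 x) xn; lia.
have : z \in nb c v a :\ x by rewrite in_setD1 nzx.
have : u \in nb c v a :\ x by rewrite in_setD1 nux.
by rewrite Ew !inE => /eqP-> /eqP->.
Qed.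

(** Within a class of two, each vertex is the only possible partner of the other. *)
Lemma class2_seen c v a x z : mdeg c v a = 2 -> x \in nb c v a -> z \in nb c v a -> seen c v x = seen c v z.
Proof.
move=> m2.
suff H u w : u \in nb c v a -> w \in nb c v a -> seen c v u \subset seen c v w.
  by move=> xn zn; apply/eqP; rewrite eqEsubset !H.
move=> un wn; apply/subsetP => y yu; case: (eqVneq w u) => [->//|nwu].
have uk : u \in linkers c v y by rewrite in_linkers (nb_adj un).
have [u' [nu u'n u'k _]] := linkers_partner uk (nb_col un).
by rewrite (nb_pair m2 un u'n wn nu nwu); apply: seen_linkers.
Qed.

Lemma class2_okc c v a x : c v = None -> mdeg c v a = 2 -> x \in nb c v a -> 2 <= #|seen c v x| -> okc c v a.
Proof.
move=> cv m2 xn s2; apply/okcP => z vz cz.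
have zn : z \in nb c v a by rewrite in_nb vz cz eqxx.
rewrite leqNgt; apply/negP => m4.
have : #|seen c v x| <= #|[set a]|.
  apply: subset_leq_card; apply/subsetP => y; rewrite (class2_seen m2 xn zn) inE => ys.
  by apply/eqP; apply: full_seen ys.
by rewrite cards1; lia.
Qed.

Lemma sum_dcol2 c x a b : a != b -> mdeg c x a + mdeg c x b + #|dcol c x| <= \sum_y mdeg c x y + 2.
Proof.
move=> nab; have := sum_dcol c x [set a; b]; rewrite big_setU1 ?inE //= big_set1 => H.
apply: leq_trans (leq_add H (leqnn 2)); rewrite -!addnA !leq_add2l.
have := cardsID [set a; b] (dcol c x) => <-; rewrite addnC leq_add2l.
by apply: leq_trans (subset_leq_card (subsetIr _ _)) _; rewrite cards2 nab.
Qed.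

Lemma two_pairs_absent c v a b : two_pairs c v a b -> 2 <= #|[set y | mdeg c v y == 0]|.
Proof.
move=> [nab ma mb _]; rewrite absent_card.
have := sum_dcol2 c v nab; have := sum_mdeg_all c v; rewrite ma mb; lia.
Qed.

Section Fixed.
Variables (c : colouring G) (v : G) (a b : colour).
Hypotheses (cr : crit c v) (t3 : two_pairs c v a b) (Q : okQ c v [:: a; b] 5).

Lemma two_pairs_single y : y != a -> y != b -> linkers c v y != set0.
Proof.
move=> na nb'; have [_ _ _ m1] := t3; apply: (single_linked opt cr); first exact: m1.
by case: Q => [H|]; [left; apply: H; rewrite !inE negb_or na|right; lia].
Qed.

(** Recolouring [x] leaves [b] as the only repeated colour. Seeing two colours rules out saturation
    in the class of [a], which then occurs only once. *)
Lemma two_pairs_recol x d : x \in nb c v a -> (forall y, mdeg c x y <= 1) -> 2 <= #|seen c v x| ->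
  mdeg c v d = 0 -> (d \in seen c v x) || (d \notin dcol c x) -> False.
Proof.
move=> xn rb s2 d0 H; have [nab ma mb m1] := t3; have [gc cv hc] := cr.
have vx := nb_adj xn; have cx := nb_col xn.
have nad : a != d by apply: contra_eq_neq ma => ->; rewrite d0.
have nbd : b != d by apply: contra_eq_neq mb => ->; rewrite d0.
have md y := recol_mdeg d cx v y; rewrite vx /= in md.
apply: (@pair_absurd _ _ _ opt _ _ b (crit_recol cr cx vx nad rb H)).
- by have := md b; rewrite (negbTE nab) mb eq_sym (negbTE nbd); lia.
- move=> q nq; have := md q; case: (eqVneq a q) => [<-|naq].
    by rewrite ma eq_sym (negbTE nad) addn0 addn1 => -[->].
  case: (eqVneq d q) => [<-|ndq]; first by rewrite d0 addn0 => ->.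
  by rewrite !addn0 => ->; apply: m1; rewrite // eq_sym.
- case: Q => [Hok|mo]; [left => y; rewrite inE => ny|right].
    apply: (recol_okc cv cx) => //; case: (eqVneq y a) => [->|nya].
      exact: class2_okc cv ma xn s2.
    by apply: Hok; rewrite !inE negb_or nya.
  by have := recol_mono d cx rb; lia.
Qed.

Lemma two_pairs_seen3 x : x \in nb c v a -> #|seen c v x| <= 3.
Proof.
move=> xn; rewrite leqNgt; apply/negP => s4; have [gc cv hc] := cr.
have rb := rainbow_card cv (nb_adj xn) (leq_trans s4 (subset_leq_card (seen_dcol c v x))).
have [d /andP[ds]] : exists d, (d \in seen c v x) && (d \in [set y | mdeg c v y == 0]).
  by apply: setI_exists; rewrite card_ord; have := two_pairs_absent t3; lia.
rewrite inE => /eqP d0; apply: (@two_pairs_recol x d) => //; last by rewrite ds.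
lia.
Qed.

Lemma two_pairs_dup x : x \in nb c v a -> #|seen c v x| = 3 ->
  dcol c x = seen c v x /\ exists2 p, mdeg c x p = 2 & forall y, y != p -> mdeg c x y <= 1.
Proof.
move=> xn s3; have [gc cv hc] := cr; have vx := nb_adj xn.
have /forallPn[p] : ~~ [forall y, mdeg c x y <= 1].
  apply/negP => /forallP rb.
  (* At most one colour is present around [x] but not seen, and at least two colours are absent
     around [v]. *)
  have [d /andP[]] : exists d, (d \in [set y | mdeg c v y == 0]) && (d \in ~: (dcol c x :\: seen c v x)).
    apply: setI_exists; rewrite card_ord.
    have := cardsC (dcol c x :\: seen c v x); rewrite card_ord.
    have := cardsD (dcol c x) (seen c v x); rewrite (setIidPr (seen_dcol c v x)) s3.
    by have := card_dcol_hole cv vx; have := two_pairs_absent t3; lia.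
  rewrite !inE negb_and negbK lt0n negbK => /eqP d0 H; apply: (@two_pairs_recol x d) => //.
    by rewrite s3.
  by rewrite !inE lt0n negbK.
rewrite -ltnNge => p2.
have d3 : #|dcol c x| <= 3.
  rewrite leqNgt; apply/negP => d4; have := rainbow_card cv vx d4 p; lia.
have E : dcol c x = seen c v x.
  by apply/esym/eqP; rewrite eqEcard seen_dcol s3.
split => //; have pD : p \in dcol c x by rewrite inE; lia.
have := mdeg_dcol cv vx pD; rewrite E s3 => p5; exists p; first by lia.
move=> y ny; have npy : p != y by rewrite eq_sym.
have := sum_dcol2 c x npy; have := sum_mdeg_hole cv vx; rewrite E s3; lia.
Qed.

Lemma two_pairs_link x1 x3 y : x1 \in nb c v a -> x3 \in nb c v b -> linkers c v y != set0 ->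
  (y \in seen c v x1) || (y \in seen c v x3).
Proof.
move=> n1 n3 /set0Pn[x xk]; have [nab ma mb m1] := t3.
have [p cx] : exists p, c x = Some p by have := seen_linkers xk => /seen_coloured.
have xn : x \in nb c v p by rewrite in_nb cx eqxx andbT; move: xk; rewrite in_linkers => /andP[].
have [x' [nx x'n _ _]] := linkers_partner xk cx.
have p2 : 2 <= mdeg c v p by apply/card_gt1P; exists x', x.
have ys := seen_linkers xk.
case: (eqVneq p a) => [pa|npa]; first by rewrite pa in xn; rewrite (class2_seen ma n1 xn) ys.
case: (eqVneq p b) => [pb|npb]; first by rewrite pb in xn; rewrite (class2_seen mb n3 xn) ys orbT.
by have := m1 p npa npb; rewrite leqNgt p2.
Qed.

Lemma two_pairs_linkers_sub x3 y : x3 \in nb c v b -> y \notin seen c v x3 -> linkers c v y \subset nb c v a.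
Proof.
move=> n3 ny; have [nab ma mb m1] := t3; apply/subsetP => x xk.
have [p cx] : exists p, c x = Some p by have := seen_linkers xk => /seen_coloured.
have xn : x \in nb c v p by rewrite in_nb cx eqxx andbT; move: xk; rewrite in_linkers => /andP[].
have [x' [nx x'n _ _]] := linkers_partner xk cx.
have p2 : 2 <= mdeg c v p by apply/card_gt1P; exists x', x.
case: (eqVneq p a) => [<-//|npa].
case: (eqVneq p b) => [pb|npb]; last by have := m1 p npa npb; rewrite leqNgt p2.
by rewrite pb in xn; move: ny; rewrite (class2_seen mb n3 xn) seen_linkers.
Qed.

(** If the [b]-pair does not see [y], the obstructions for [y] have both ends in the [a]-pair, and
    moving the hole to [x] destroys them. *)
Lemma two_pairs_shift x x3 y : x \in nb c v a -> x3 \in nb c v b -> y \notin seen c v x3 -> okc c v y ->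
  crit (shift c v x y) x.
Proof.
move=> xn n3 ny ok; have [nab ma mb m1] := t3.
apply: (crit_shift cr (nb_col xn) (nb_adj xn)).
- have := subset_leq_card (setSD [set x] (two_pairs_linkers_sub n3 ny)).
  by have := ma; rewrite /mdeg (cardsD1 x) xn; lia.
- by move=> z vz cz _; apply: (okcP _ _ _ ok).
- have : mdeg c v y <= 2; last by lia.
  by case: (eqVneq y a) => [->|na]; [rewrite ma|case: (eqVneq y b) => [->|nb']; [rewrite mb|have := m1 y na nb'; lia]].
Qed.

End Fixed.

Section Both.
Variables (c : colouring G) (v : G) (a b : colour).
Hypotheses (cr : crit c v) (t3 : two_pairs c v a b) (Q : okQ c v [:: a; b] 5).

Lemma two_pairs_nb : exists x1 x3, x1 \in nb c v a /\ x3 \in nb c v b.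
Proof.
have [nab ma mb m1] := t3.
have /card_gt0P[x1 n1] : 0 < mdeg c v a by rewrite ma.
have /card_gt0P[x3 n3] : 0 < mdeg c v b by rewrite mb.
by exists x1, x3.
Qed.

(** A saturated vertex of the [a]-pair leaves every colour other than [a] to the [b]-pair, which
    would see four colours or, if itself saturated, only [b]. *)
Lemma two_pairs_okc : okc c v a.
Proof.
have [gc cv hc] := cr; have [nab ma mb m1] := t3.
have [x1 [x3 [n1 n3]]] := two_pairs_nb.
case: (boolP (okc c v a)) => // /forall_inPn[u un]; rewrite -ltnNge => m4.
have H y : y != a -> linkers c v y != set0 -> y \in seen c v x3.
  move=> na L; case/orP: (two_pairs_link t3 un n3 L) => // ys.
  by rewrite (full_seen cv (nb_adj un) m4 ys) eqxx in na.
have s3 := two_pairs_seen3 cr (two_pairs_sym t3) (okQ_sym Q) n3.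
have [Lb|/forall_inPn[w wn]] : linkers c v b != set0 \/ ~~ okc c v b.
- by apply: (crit_block opt cr); rewrite mb.
- move: s3; rewrite leqNgt => /negP[].
  have c4 : #|~: [set a]| = 4 by rewrite cardsC1 card_ord.
  apply: leq_trans (eq_leq (esym c4)) _; apply: subset_leq_card; apply/subsetP => y.
  rewrite in_setC1 => na; apply: H => //; case: (eqVneq y b) => [->//|nb'].
  exact: (two_pairs_single cr t3 Q).
- rewrite -ltnNge => w4.
  have [y /andP[]] : exists y, (y \in ~: [set a]) && (y \in ~: [set b]).
    by apply: setI_exists; rewrite !cardsC1 !card_ord.
  rewrite !in_setC1 => na nb'.
  have := H y na (two_pairs_single cr t3 Q na nb'); rewrite (class2_seen mb n3 wn) => ys.
  by rewrite (full_seen cv (nb_adj wn) w4 ys) eqxx in nb'.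
Qed.

End Both.

Section Rigid.
Variables (c : colouring G) (v : G) (a b : colour).
Hypotheses (cr : crit c v) (t3 : two_pairs c v a b) (Q : okQ c v [:: a; b] 5).

Lemma two_pairs_linked y : linkers c v y != set0.
Proof.
have [nab ma mb m1] := t3.
case: (eqVneq y a) => [->|na].
  by case: (crit_block (y := a) opt cr); rewrite ?ma // (two_pairs_okc cr t3 Q).
case: (eqVneq y b) => [->|nb']; last exact: (two_pairs_single cr t3 Q).
by case: (crit_block (y := b) opt cr); rewrite ?mb // (two_pairs_okc cr (two_pairs_sym t3) (okQ_sym Q)).
Qed.

Lemma two_pairs_cover x1 x3 : x1 \in nb c v a -> x3 \in nb c v b -> seen c v x1 :|: seen c v x3 = setT.
Proof.
move=> n1 n3; apply/setP => y; rewrite in_setU in_setT.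
by rewrite (two_pairs_link t3 n1 n3 (two_pairs_linked y)).
Qed.

End Rigid.

(** This supplies the [okc] alternative of [okQ] at the new hole, where [mono] is no longer
    controlled. *)
Lemma shift_okc c v x p y s : good c -> c v = None -> c x = Some p -> adj v x ->
  dcol c x = seen c v x -> (forall y', y' \notin s -> mdeg c x y' <= 1) -> y \in s ->
  forall y', y' \notin s -> okc (shift c v x y) x y'.
Proof.
move=> gc cv cx vx E m1 ys y' ny'.
have nyy : y' != y by apply: contraNneq ny' => ->.
case: (posnP (mdeg c x y')) => [m0|m0].
  apply/forall_inP => z zn; have := shift_mdeg_new y cv cx vx y'.
  rewrite m0 eq_sym (negbTE nyy) => /eqP; rewrite cards_eq0 => /eqP E0.
  by rewrite E0 inE in zn.
have yD : y' \in seen c v x by rewrite -E inE.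
apply: (shift_ok cv cx vx) => //.
by apply/eqP; rewrite eqn_leq m1.
Qed.

Definition dup c x p := mdeg c x p = 2 /\ forall y, y != p -> mdeg c x y <= 1.

(** With [v] coloured [p], the colour [p] occurs three times around the new hole: type (3,1,1). *)
Lemma shift_dup_absurd c v x p : crit c v -> adj v x -> dcol c x = seen c v x -> dup c x p ->
  crit (shift c v x p) x -> False.
Proof.
move=> [gc cv hc] vx E [p2 m1] cr'.
have [q cx] : exists q, c x = Some q.
  have : p \in dcol c x by rewrite inE p2.
  by rewrite E => /seen_coloured.
apply: (triple_absurd (a := p) opt cr').
- by have := shift_mdeg_new p cv cx vx p; rewrite eqxx p2.
- by move=> y ny; have := shift_mdeg_new p cv cx vx y; rewrite eq_sym (negbTE ny); have := m1 y ny; lia.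
- left; apply: (shift_okc gc cv cx vx E); last by rewrite inE.
  by move=> y; rewrite inE; apply: m1.
Qed.

(* The four neighbours of [v] in the two repeated colours all see the same colour [p] twice. *)
Definition rigid c v a b p :=
  [/\ forall x, x \in nb c v a \/ x \in nb c v b -> [/\ dcol c x = seen c v x, #|seen c v x| = 3 & dup c x p],
      forall x1 x3, x1 \in nb c v a -> x3 \in nb c v b ->
        seen c v x1 :&: seen c v x3 = [set p] /\ seen c v x1 :|: seen c v x3 = setT
    & forall y, okc c v y].

(** If the other pair did not see the repeated colour [p], the hole could move to [x1] with [v]
    receiving [p]. *)
Lemma two_pairs_half c v a b x1 x3 : crit c v -> two_pairs c v a b -> (forall y, y \notin [:: a; b] -> okc c v y) ->
  x1 \in nb c v a -> x3 \in nb c v b -> #|seen c v x1| = 3 ->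
  exists p, [/\ dup c x1 p, p \in seen c v x1 & p \in seen c v x3].
Proof.
move=> cr t3 ok n1 n3 s1; have Q : okQ c v [:: a; b] 5 by left.
have [E [p p2 m1]] := two_pairs_dup cr t3 Q n1 s1.
have ps : p \in seen c v x1 by rewrite -E inE p2.
exists p; split => //; case: (boolP (p \in seen c v x3)) => // np.
have okp : okc c v p.
  case: (boolP (p \in [:: a; b])) => [|/ok//]; rewrite !inE => /orP[] /eqP->.
    exact: two_pairs_okc cr t3 Q.
  exact: two_pairs_okc cr (two_pairs_sym t3) (okQ_sym Q).
by case: (shift_dup_absurd cr (nb_adj n1) E _ (two_pairs_shift cr t3 n1 n3 np okp)).
Qed.

Lemma two_pairs_rigid c v a b : crit c v -> two_pairs c v a b -> (forall y, y \notin [:: a; b] -> okc c v y) ->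
  exists p, rigid c v a b p.
Proof.
move=> cr t3 ok; have Q : okQ c v [:: a; b] 5 by left.
have [nab ma mb m1] := t3; have Q' := okQ_sym Q; have t3' := two_pairs_sym t3.
have ok' y : y \notin [:: b; a] -> okc c v y by move=> H; apply: ok; move: H; rewrite !inE orbC.
have [x1 [x3 [n1 n3]]] := two_pairs_nb t3.
have s1 := two_pairs_seen3 cr t3 Q n1; have s3 := two_pairs_seen3 cr t3' Q' n3.
have U := two_pairs_cover cr t3 Q n1 n3.
have UI := cardsUI (seen c v x1) (seen c v x3); rewrite U cardsT card_ord in UI.
have I0 : #|seen c v x1| = 3 \/ #|seen c v x3| = 3 -> 0 < #|seen c v x1 :&: seen c v x3|.
  case=> s; [have [p [_ ? ?]] := two_pairs_half cr t3 ok n1 n3 s|have [p [_ ? ?]] := two_pairs_half cr t3' ok' n3 n1 s];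
  by apply/card_gt0P; exists p; apply/setIP.
(* The two sets cover five colours and have at most three elements each, so one has three; a common
   colour then forces three in both, with exactly one in common. *)
have {}I0 : 0 < #|seen c v x1 :&: seen c v x3| by apply: I0; lia.
have e1 : #|seen c v x1| = 3 by lia.
have e3 : #|seen c v x3| = 3 by lia.
have [p [d1 p1 p3]] := two_pairs_half cr t3 ok n1 n3 e1.
have /cards1P[w Ew] : #|seen c v x1 :&: seen c v x3| == 1 by lia.
have Ip y : y \in seen c v x1 -> y \in seen c v x3 -> y = p.
  move=> h1 h3; have : y \in [set w] by rewrite -Ew inE h1.
  by have : p \in [set w]; [rewrite -Ew inE p1|rewrite !inE => /eqP-> /eqP->].
have Hx1 x : x \in nb c v a -> [/\ dcol c x = seen c v x, #|seen c v x| = 3 & dup c x p].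
  move=> xn; have es := class2_seen ma xn n1; have ex : #|seen c v x| = 3 by rewrite es.
  split => //; first by case: (two_pairs_dup cr t3 Q xn ex).
  have [q [dq q1 q3]] := two_pairs_half cr t3 ok xn n3 ex.
  by rewrite -(Ip q) // -es.
have Hx3 x : x \in nb c v b -> [/\ dcol c x = seen c v x, #|seen c v x| = 3 & dup c x p].
  move=> xn; have es := class2_seen mb xn n3; have ex : #|seen c v x| = 3 by rewrite es.
  split => //; first by case: (two_pairs_dup cr t3' Q' xn ex).
  have [q [dq q1 q3]] := two_pairs_half cr t3' ok' xn n1 ex.
  by rewrite -(Ip q) // -es.
exists p; split.
- by move=> x [/Hx1|/Hx3].
- move=> u1 u3 un1 un3; rewrite (class2_seen ma un1 n1) (class2_seen mb un3 n3); split => //.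
  apply/setP => y; rewrite in_setI in_set1; apply/andP/eqP => [[]|->]; by [apply: Ip|].
- move=> y; case: (boolP (y \in [:: a; b])) => [|/ok//]; rewrite !inE => /orP[] /eqP->.
    exact: two_pairs_okc cr t3 Q.
  exact: two_pairs_okc cr t3' Q'.
Qed.

End Type3.

(** * Excluding multiplicities (2,2,1) *)

Section Type3End.
Variables (G : graph5) (h M0 : nat).
Hypothesis opt : optimal G h M0.
Implicit Types (c : colouring G) (v x z : G) (p q y d a b : colour) (s : seq colour).
Local Notation crit := (@crit G h).
Local Notation okQ := (@okQ G M0).

(* Moving the hole from [v] to [x] with [v] receiving [q], and then on to [w], shows that the colour
   repeated around the [d]-coloured neighbours of [w] is [q]. Two choices of [q] are possible, but a
   vertex not adjacent to [v] does not notice the difference. *)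
Section Chain.
Variables (c : colouring G) (v : G) (a b p : colour) (x w : G).
Hypotheses (cr : crit c v) (t3 : two_pairs c v a b) (rg : rigid c v a b p).
Hypotheses (xn : x \in nb c v a) (wn : w \in nb c x p).
Local Notation cq q := (shift c v x q).
(** The colours around [v] after [x] is uncoloured: [a] counts one less. The set does not depend on
    [q]. *)
Local Notation A := [set y | (a == y) < mdeg c v y].

Let cv : c v = None. Proof. by have [] := cr. Qed.
Let cx := nb_col xn.
Let vx := nb_adj xn.
Let nxv := adj_neq vx.
Let nwx := adj_neq (nb_adj wn).
Let nwv : w != v. Proof. by apply: contra_eq_neq cv => <-; rewrite (nb_col wn). Qed.

Lemma chain_mdeg_v q y : mdeg (cq q) v y + (a == y) = mdeg c v y.
Proof. by have := shift_mdeg q cv cx vx v y; rewrite vx adjxx addn0. Qed.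

(** Around [x] the colour [p] occurs twice and [q] once; [v] turning [q] makes a second pair, so
    rigidity applies again at [x]. *)
Lemma chain1 q : q \in seen c v x -> q != p ->
  [/\ crit (cq q) x, two_pairs (cq q) x p q, rigid (cq q) x p q b, v \in nb (cq q) x q & w \in nb (cq q) x p].
Proof.
move=> qs nqp; have [gc _ _] := cr; have [r1 r2 r3] := rg.
have [E s3 [p2 m1]] := r1 x (or_introl xn).
have [_ [x3 [_ n3]]] := two_pairs_nb t3.
have nq3 : q \notin seen c v x3.
  apply: contra nqp => q3; have [I _] := r2 x x3 xn n3.
  by rewrite -in_set1 -I in_setI qs.
have crq : crit (cq q) x := two_pairs_shift cr t3 xn n3 nq3 (r3 q).
have mq : mdeg c x q = 1.
  have : q \in dcol c x by rewrite E.
  by rewrite inE => q0; apply/eqP; rewrite eqn_leq q0 m1.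
have t3q : two_pairs (cq q) x p q.
  have md := shift_mdeg_new q cv cx vx.
  split; rewrite ?md ?p2 ?mq ?eqxx ?(negbTE nqp) //; first by rewrite eq_sym.
  by move=> y np nq; rewrite md eq_sym (negbTE nq) addn0 m1.
have okq y : y \notin [:: p; q] -> okc (cq q) x y.
  apply: (shift_okc gc cv cx vx E); last by rewrite !inE eqxx orbT.
  by move=> y'; rewrite !inE negb_or => /andP[/m1].
have [P rgq] := two_pairs_rigid opt crq t3q okq.
have vn : v \in nb (cq q) x q by rewrite in_nb adjC vx shift_at eqxx.
have [_ _ [P2 Pm]] := let: And3 h1 _ _ := rgq in h1 v (or_intror vn).
(* The vertex [v] belongs to the [q]-pair around [x] and still has both its [b]-neighbours, so its
   repeated colour is [b]. *)
have bP : P = b.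
  apply/esym/eqP; apply/negPn/negP => /Pm; have := chain_mdeg_v q b.
  by have [nab _ mb _] := t3; rewrite mb (negbTE nab) addn0 => ->.
split => //; first by rewrite -bP.
by rewrite in_nb (nb_adj wn) shift_other ?(nb_col wn) ?eqxx.
Qed.

Lemma chain_dcol_v q : dcol (cq q) v = A.
Proof. by apply/setP => y; rewrite !inE -(chain_mdeg_v q y); lia. Qed.

(** By rigidity the colours seen by [w] and [v] cover everything and share only [b]. This determines
    the multiplicities around [w] by [A] and [b], independently of [q]. *)
Lemma chain_w q : q \in seen c v x -> q != p ->
  [/\ forall y, mdeg (cq q) w y = if y == b then 2 else (y \notin A),
      dcol (cq q) w = seen (cq q) x w & seen (cq q) x v = A].
Proof.
move=> qs nqp; have [crq t3q [r1 r2 r3] vn wn'] := chain1 qs nqp.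
have [Ev sv dv] := r1 v (or_intror vn).
have [Ew sw [b2 m1]] := r1 w (or_introl wn').
have [I U] := r2 w v wn' vn.
split => //; last by rewrite -Ev chain_dcol_v.
move=> y; case: eqVneq => [->//|nyb].
have nI : (y \in dcol (cq q) w) && (y \in A) = false.
  by rewrite -(chain_dcol_v q) Ew Ev -in_setI I in_set1 (negbTE nyb).
have yU : (y \in dcol (cq q) w) || (y \in A).
  by rewrite -(chain_dcol_v q) Ew Ev -in_setU U in_setT.
have yw : (y \in dcol (cq q) w) = (y \notin A).
  by move: nI yU; case: (y \in dcol _ _); case: (y \in A).
have := m1 y nyb; move: yw; rewrite inE => <-.
by case: (mdeg _ _ _) => [|[|]].
Qed.

(** If [w] were adjacent to [v], its count of [q] would change when [v] receives [r] instead of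
    [q]. *)
Lemma chain_nadj q r : q \in seen c v x -> q != p -> r \in seen c v x -> r != p -> q != r -> ~~ adj w v.
Proof.
move=> qs nqp rs nrp nqr.
have [mq _ _] := chain_w qs nqp; have [mr _ _] := chain_w rs nrp.
have := shift_mdeg q cv cx vx w q; have := shift_mdeg r cv cx vx w q.
rewrite mq mr eqxx [r == q]eq_sym (negbTE nqr) andbF andbT.
by case: (adj w v) => //; clear; lia.
Qed.

Lemma chain2 q d : q \in seen c v x -> q != p -> d \notin A ->
  rigid (shift (cq q) x w d) w d b q.
Proof.
move=> qs nqp dA; have [crq t3q [r1 r2 r3] vn wn'] := chain1 qs nqp.
have [gq hq _] := crq.
have [mw Ew sv] := chain_w qs nqp.
have [nab ma mb m1] := t3.
have bA : b \in A by rewrite inE mb (negbTE nab).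
have nbd : d != b by apply: contraNneq dA => ->.
have xw : adj x w := nb_adj wn'.
have cw : cq q w = Some p := nb_col wn'.
have cr2 : crit (shift (cq q) x w d) w.
  by apply: (two_pairs_shift crq t3q wn' vn); rewrite ?sv.
have md := shift_mdeg_new d hq cw xw.
have t32 : two_pairs (shift (cq q) x w d) w d b.
  split => //; rewrite ?md ?mw ?eqxx ?(negbTE nbd) ?dA //.
  by move=> y nd nb'; rewrite md mw (negbTE nb') eq_sym (negbTE nd) addn0; case: (_ \notin _).
have ok2 y : y \notin [:: d; b] -> okc (shift (cq q) x w d) w y.
  apply: (shift_okc gq hq cw xw Ew); last by rewrite !inE eqxx.
  by move=> y'; rewrite !inE negb_or => /andP[_ nb']; rewrite mw (negbTE nb'); case: (_ \notin _).
have [P rg2] := two_pairs_rigid opt cr2 t32 ok2.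
have xn2 : x \in nb (shift (cq q) x w d) w d by rewrite in_nb adjC xw shift_at eqxx.
have [_ _ [P2 Pm]] := let: And3 h1 _ _ := rg2 in h1 x (or_introl xn2).
(* The vertex [x] lies in the new [d]-pair around [w], and [q] still occurs twice around it. *)
have Pq : P = q; last by rewrite Pq in rg2.
apply/esym/eqP/negPn/negP => /Pm.
have := shift_mdeg d hq cw xw x q; rewrite eq_sym (negbTE nqp) andbF adjxx !addn0 => ->.
by have [_ _ -> _] := t3q.
Qed.

Lemma chain_absurd : False.
Proof.
have [r1 _ _] := rg; have [E s3 [p2 m1]] := r1 x (or_introl xn).
have ps : p \in seen c v x by rewrite -E inE p2.
have [q [r [qs rs nqr]]] : exists q r, [/\ q \in seen c v x :\ p, r \in seen c v x :\ p & q != r].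
  have : 1 < #|seen c v x :\ p| by move: s3; rewrite (cardsD1 p) ps; lia.
  by case/card_gt1P => q [r [? ? ?]]; exists q, r.
move: qs rs; rewrite !in_setD1 => /andP[nqp qs] /andP[nrp rs].
have nwav := chain_nadj qs nqp rs nrp nqr.
have [crq t3q rgq vn wn'] := chain1 qs nqp.
have [d dA] : exists d, d \in ~: A.
  apply/card_gt0P; have := cardsC A; rewrite card_ord -(chain_dcol_v q).
  have [E' s3' _] := let: And3 h1 _ _ := rgq in h1 v (or_intror vn).
  by rewrite E' s3'; clear; lia.
rewrite in_setC in dA.
have [mw _ _] := chain_w qs nqp.
have [nab ma mb _] := t3.
have nda : d != a by apply: contraNneq dA => ->; rewrite inE eqxx ma.
have ndb : d != b by apply: contraNneq dA => ->; rewrite inE mb (negbTE nab).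
have /card_gt0P[z zn] : 0 < mdeg (cq q) w d by rewrite mw (negbTE ndb) dA.
have wz := nb_adj zn; have czq := nb_col zn.
have nzv : z != v by apply: contraNneq nwav => <-.
have nzx : z != x by apply: contra_eq_neq czq => ->; rewrite shift_hole.
have nzw : z != w := adj_neq wz.
have cz : c z = Some d by rewrite shift_other in czq.
(* A neighbour of [v] coloured [d] would put [d] into [A]. *)
have nzav : ~~ adj z v.
  apply: contra dA => zv; rewrite inE [a == d]eq_sym (negbTE nda).
  by apply/card_gt0P; exists z; rewrite in_nb adjC zv cz eqxx.
have main u : u \in seen c v x -> u != p ->
    mdeg (shift (cq u) x w d) z u = 2 /\ forall y, y != u -> mdeg (shift (cq u) x w d) z y <= 1.
  move=> us nup; have [h1 _ _] := chain2 us nup dA.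
  have [crq' t3q' rgq' vn' wn''] := chain1 us nup.
  have zn2 : z \in nb (shift (cq u) x w d) w d.
    by rewrite in_nb wz !shift_other // cz eqxx.
  by have [_ _ []] := h1 z (or_introl zn2).
have [zq _] := main q qs nqp; have [_ zr] := main r rs nrp.
(* The count of [q] around [z] is the same for both choices, although rigidity demands two for [q]
   and at most one for [r]. *)
have key u : u \in seen c v x -> u != p ->
   mdeg (shift (cq u) x w d) z q + (adj z w && (p == q)) + (adj z x && (a == q)) = mdeg c z q + (adj z x && (d == q)).
  move=> us nup; have [[_ hu _] _ _ _ wn''] := chain1 us nup.
  have := shift_mdeg d hu (nb_col wn'') (nb_adj wn'') z q.
  by have := shift_mdeg u cv cx vx z q; rewrite (negbTE nzav) /=; clear; lia.
have := key r rs nrp; have := key q qs nqp; have := zr q nqr; rewrite zq; clear; lia.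
Qed.

End Chain.

Lemma two_pairs_ok_absurd c v a b : crit c v -> two_pairs c v a b -> (forall y, y \notin [:: a; b] -> okc c v y) -> False.
Proof.
move=> cr t3 ok; have [p rg] := two_pairs_rigid opt cr t3 ok.
have [x [_ [xn _]]] := two_pairs_nb t3.
have [_ _ [p2 _]] := let: And3 h1 _ _ := rg in h1 x (or_introl xn).
have /card_gt0P[w wn] : 0 < mdeg c x p by rewrite p2.
exact: chain_absurd cr t3 rg xn wn.
Qed.

(** Around [x] there are three colours with at most one repeated, so adding [y] gives at most one
    pair, (3,1,1) or (2,2,1), all excluded. *)
Lemma shift_three_seen_absurd c v x y : crit c v -> adj v x -> dcol c x = seen c v x -> #|seen c v x| = 3 ->
  y \in seen c v x -> crit (shift c v x y) x -> False.
Proof.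
move=> cr vx E s3 ys cr'; have [gc cv hc] := cr.
have [a cx] := seen_coloured ys.
have md := shift_mdeg_new y cv cx vx.
have y0 : 0 < mdeg c x y by have : y \in dcol c x; [rewrite E|rewrite inE].
have [rb|[p p2]] : (forall q, mdeg c x q <= 1) \/ exists p, 2 <= mdeg c x p.
  case: (boolP [forall q, mdeg c x q <= 1]) => [/forallP|/forallPn[p]]; first by left.
  by rewrite -ltnNge; right; exists p.

  apply: (pair_absurd (a := y) opt cr').
  - by rewrite md eqxx; have := rb y; lia.
  - by move=> q nq; rewrite md eq_sym (negbTE nq); have := rb q; lia.
  - left; apply: (shift_okc gc cv cx vx E); last by rewrite inE.
    by move=> q _; apply: rb.
have pD : p \in dcol c x by rewrite inE; lia.
have dp : dup c x p.
  have := mdeg_dcol cv vx pD; rewrite E s3 => p5; split; first by lia.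
  move=> q nq; have npq : p != q by rewrite eq_sym.
  have := sum_dcol2 c x npq; have := sum_mdeg_hole cv vx; rewrite E s3; lia.
have [p2' m1] := dp.
case: (eqVneq y p) => [yp|nyp]; first by apply: (shift_dup_absurd opt cr vx E dp); rewrite -yp.
apply: (@two_pairs_ok_absurd (shift c v x y) x p y cr').
  split; rewrite ?md ?eqxx ?(negbTE nyp) ?addn0 //; first by rewrite eq_sym.
  - by have := m1 y nyp; lia.
  - by move=> q np nq; rewrite md eq_sym (negbTE nq) addn0 m1.
apply: (shift_okc gc cv cx vx E); last by rewrite !inE eqxx orbT.
by move=> q; rewrite !inE negb_or => /andP[/m1].
Qed.

Lemma two_pairs_half_absurd c v a b x1 x3 : crit c v -> two_pairs c v a b -> okQ c v [:: a; b] 5 ->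
  x1 \in nb c v a -> x3 \in nb c v b -> #|seen c v x1| = 3 -> False.
Proof.
move=> cr t3 Q n1 n3 s1; have [E _] := two_pairs_dup opt cr t3 Q n1 s1.
have s3 := two_pairs_seen3 opt cr (two_pairs_sym t3) (okQ_sym Q) n3.
have U := two_pairs_cover opt cr t3 Q n1 n3.
have D2 : 2 <= #|seen c v x1 :\: seen c v x3|.
  have := cardsID (seen c v x3) (seen c v x1).
  have := cardsUI (seen c v x1) (seen c v x3); rewrite U cardsT card_ord; lia.
have [nab ma mb _] := t3.
have [y [ys ok]] : exists y, y \in seen c v x1 :\: seen c v x3 /\ okc c v y.
  case/card_gt1P: D2 => y1 [y2 [h1 h2 n12]].
  case: (boolP (okc c v y1)) => [|o1]; first by exists y1.
  exists y2; split => //; apply/negPn/negP => o2.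
  (* Two failing colours would both occur around [v] besides the two pairs, which makes six
     neighbours. *)
  have H y : ~~ okc c v y -> y \notin [:: a; b] /\ 0 < mdeg c v y.
    move=> no; split; last by case/forall_inPn: no => z zn _; apply/card_gt0P; exists z.
    apply/negP; rewrite !inE => /orP[] /eqP yE; move: no; rewrite yE.
      by rewrite (two_pairs_okc opt cr t3 Q).
    by rewrite (two_pairs_okc opt cr (two_pairs_sym t3) (okQ_sym Q)).
  have [k1 g1] := H _ o1; have [k2 g2] := H _ o2.
  have us : uniq [:: a; b; y1; y2].
    move: k1 k2; rewrite /= !inE !negb_or nab n12 /= ![_ == a]eq_sym ![_ == b]eq_sym.
    by move=> /andP[-> ->] /andP[-> ->].
  have := @sum_mdeg _ c v [:: a; b; y1; y2] set0 us.
  rewrite cards0 !big_cons big_nil ma mb => Hs.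
  have : 2 + (2 + (mdeg c v y1 + (mdeg c v y2 + 0))) + 0 <= 5 by apply: Hs => z; rewrite inE.
  by move: g1 g2; clear; lia.
move: ys; rewrite in_setD => /andP[ny3 y1].
exact: (shift_three_seen_absurd cr (nb_adj n1) E s1 y1 (two_pairs_shift cr t3 n1 n3 ny3 ok)).
Qed.

Lemma two_pairs_absurd c v a b : crit c v -> two_pairs c v a b -> okQ c v [:: a; b] 5 -> False.
Proof.
move=> cr t3 Q; have [x1 [x3 [n1 n3]]] := two_pairs_nb t3.
have t3' := two_pairs_sym t3; have Q' := okQ_sym Q.
have s1 := two_pairs_seen3 opt cr t3 Q n1; have s3 := two_pairs_seen3 opt cr t3' Q' n3.
have := cardsUI (seen c v x1) (seen c v x3).
rewrite (two_pairs_cover opt cr t3 Q n1 n3) cardsT card_ord => UI.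
case: (eqVneq #|seen c v x1| 3) => [e1|n31]; first exact: two_pairs_half_absurd cr t3 Q n1 n3 e1.
apply: (two_pairs_half_absurd cr t3' Q' n3 n1); lia.
Qed.

End Type3End.

(** * Sums over finite sets, for double counting *)

Lemma leq_sum_const (I : finType) (X : {set I}) (f : I -> nat) k :
  (forall x, x \in X -> f x <= k) -> \sum_(x in X) f x <= #|X| * k.
Proof. by move=> H; rewrite -sum_nat_const; apply: leq_sum. Qed.

Lemma geq_sum_const (I : finType) (X : {set I}) (f : I -> nat) k :
  (forall x, x \in X -> k <= f x) -> #|X| * k <= \sum_(x in X) f x.
Proof. by move=> H; rewrite -sum_nat_const; apply: leq_sum. Qed.

Lemma sum_set_split (I : finType) (X : {set I}) (P : pred I) (f : I -> nat) :
  \sum_(x in X) f x = \sum_(x in [set x in X | P x]) f x + \sum_(x in [set x in X | ~~ P x]) f x.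
Proof. by rewrite (bigID P) /=; congr (_ + _); apply: eq_bigl => x; rewrite inE. Qed.

Lemma card_set_split (I : finType) (X : {set I}) (P : pred I) :
  #|X| = #|[set x in X | P x]| + #|[set x in X | ~~ P x]|.
Proof. by rewrite -!sum1_card; apply: sum_set_split. Qed.

(** * A colour appearing four times *)

Section Type4.
Variables (G : graph5) (h M0 : nat).
Hypothesis opt : optimal G h M0.
Implicit Types (c : colouring G) (v x z : G) (p q y d a b : colour) (s : seq colour).
Local Notation crit := (@crit G h).
Local Notation okQ := (@okQ G M0).

Lemma sum_mdeg2 c x a b : a != b -> mdeg c x a + mdeg c x b <= 5.
Proof.
move=> nab; have us : uniq [:: a; b] by rewrite /= inE nab.
have := @sum_mdeg _ c x [:: a; b] set0 us; rewrite cards0 !big_cons big_nil !addn0 => H.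
by apply: H => z; rewrite inE.
Qed.

Lemma absent_okc c v y : mdeg c v y = 0 -> okc c v y.
Proof.
by move=> /eqP; rewrite cards_eq0 => /eqP E; apply/forall_inP => z; rewrite E inE.
Qed.

(** [Z] consists of target colours whose use in recolouring [x] is contradictory. In each case there
    are enough of them to meet the colours usable for [x]. *)
Lemma rainbow_free c v x (Z : {set colour}) : c v = None -> adj v x -> 3 <= #|Z| ->
  (forall d, d \in Z -> (forall y, mdeg c x y <= 1) -> (d \in seen c v x) || (d \notin dcol c x) -> False) ->
  #|seen c v x| <= 3 /\ (#|seen c v x| = 3 -> dcol c x = seen c v x).
Proof.
move=> cv vx Z3 H; split.
  rewrite leqNgt; apply/negP => s4.
  have rb := rainbow_card cv vx (leq_trans s4 (subset_leq_card (seen_dcol c v x))).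
  have [d /andP[ds dZ]] : exists d, (d \in seen c v x) && (d \in Z).
    by apply: setI_exists; rewrite card_ord; apply: leq_trans (leq_add s4 Z3).
  by apply: (H d dZ rb); rewrite ds.
move=> s3; apply/esym/eqP; rewrite eqEcard seen_dcol s3 leqNgt; apply/negP => d4.
have rb := rainbow_card cv vx d4.
have [d /andP[dZ]] : exists d, (d \in Z) && (d \in ~: (dcol c x :\: seen c v x)).
  have H4 : 4 <= #|~: (dcol c x :\: seen c v x)|.
    have := cardsC (dcol c x :\: seen c v x); rewrite card_ord.
    have := cardsD (dcol c x) (seen c v x); rewrite (setIidPr (seen_dcol c v x)) s3.
    by have := card_dcol_hole cv vx; clear; lia.
  by apply: setI_exists; rewrite card_ord; apply: leq_trans (leq_add Z3 H4).
rewrite in_setC in_setD negb_and negbK => /(H d dZ rb) //.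
Qed.

Lemma quadruple_absurd c v a : crit c v -> mdeg c v a = 4 -> okQ c v [:: a] 3 -> False.
Proof.
move=> cr ma Q; have [gc cv hc] := cr.
have m1 y : y != a -> mdeg c v y <= 1.
  by move=> ny; have := sum_mdeg2 c v ny; rewrite ma; clear; lia.
have lin y : y != a -> linkers c v y != set0.
  move=> ny; apply: (single_linked opt cr); first exact: m1.
  by case: Q => [H|mo]; [left; apply: H; rewrite inE|right; move: mo; clear; lia].
pose A := [set y | mdeg c v y == 0].
have nA y : y \in A -> y != a by rewrite inE; apply: contraTneq => ->; rewrite ma.
have A3 : 3 <= #|A|.
  rewrite absent_card; have := sum_dcol c v [set a]; rewrite big_set1 (cardsD1 a (dcol c v)) inE ma.
  by have := sum_mdeg_all c v; clear; lia.
have fr x : x \in nb c v a -> #|seen c v x| <= 3 /\ (#|seen c v x| = 3 -> dcol c x = seen c v x).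
  move=> xn; apply: (rainbow_free cv (nb_adj xn) A3) => d dA rb H.
  have nad : a != d by rewrite eq_sym nA.
  move: dA; rewrite inE => /eqP d0.
  have cx := nb_col xn; have vx := nb_adj xn.
  have md y := recol_mdeg d cx v y; rewrite vx /= in md.
  apply: (triple_absurd (a := a) opt (crit_recol cr cx vx nad rb H)).
  - by have := md a; rewrite eqxx ma eq_sym (negbTE nad) addn0 addn1 => -[].
  - move=> q nq; have := md q; rewrite [a == q]eq_sym (negbTE nq) addn0 => ->.
    by case: (eqVneq d q) => [<-|_]; [rewrite d0|rewrite addn0 m1].
  - case: Q => [Hok|mo]; [left => y ny|right].
      by apply: (recol_okc cv cx) => //; apply: Hok.
    by have := recol_mono d cx rb; move: mo; clear; lia.
(* With only two linkers the hole can move to [x], which is contradictory if [x] sees three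
   colours. *)
have solo x y : x \in linkers c v y -> y \in A -> #|linkers c v y| = 2 -> #|seen c v x| <= 2.
  move=> xk yA k2; have xn := subsetP (linkers_class y m1) _ xk.
  have [s3 E] := fr x xn; rewrite leq_eqVlt in s3; case/orP: s3 => [/eqP s3|//].
  move: yA; rewrite inE => /eqP y0.
  case: (@shift_three_seen_absurd _ _ _ opt c v x y cr (nb_adj xn) (E s3) s3 (seen_linkers xk)).
  apply: (crit_shift cr (nb_col xn) (nb_adj xn)).
  - by move: k2; rewrite (cardsD1 x) xk; clear; lia.
  - by move=> z vz cz _; apply: (okcP _ _ _ (absent_okc y0)).
  - by rewrite y0.
pose X := nb c v a.
have HX x : x \in X -> adj v x by apply: nb_adj.
pose P (x : G) := #|seen c v x| <= 2.
pose X' := [set x in X | P x].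
pose R (y : colour) := #|linkers c v y| == 2.
pose A' := [set y in A | R y].
have LX y : linkers c v y :&: X = linkers c v y by apply/setIidPl/linkers_class.
have E1 : \sum_(x in X) #|seen c v x| = \sum_(y in [set: colour]) #|linkers c v y|.
  transitivity (\sum_(x in X) #|seen c v x :&: setT|); first by apply: eq_bigr => x _; rewrite setIT.
  by rewrite double_count //; apply: eq_bigr => y _; rewrite LX.
have E2 : \sum_(x in X') #|seen c v x :&: A'| = #|A'| * 2.
  rewrite double_count => [|x]; last by rewrite inE => /andP[/HX].
  rewrite -sum_nat_const; apply: eq_bigr => y; rewrite inE => /andP[yA /eqP k2].
  rewrite (setIidPl _) //; apply/subsetP => x xk.
  by rewrite inE (subsetP (linkers_class y m1) _ xk) /P (solo x y).
have E3 : \sum_(x in X') #|seen c v x :&: A'| <= \sum_(x in X') #|seen c v x|.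
  by apply: leq_sum => x _; apply: subset_leq_card; apply: subsetIl.
have cX : #|X| = 4 by exact: ma.
have U1 : \sum_(x in X) #|seen c v x| <= \sum_(x in X') #|seen c v x| + (4 - #|X'|) * 3.
  rewrite (sum_set_split X P) leq_add2l.
  have -> : 4 - #|X'| = #|[set x in X | ~~ P x]| by rewrite -cX (card_set_split X P) addKn.
  by apply: leq_sum_const => x; rewrite inE => /andP[/fr[]].
have L1 : #|A| * 3 <= \sum_(y in A) #|linkers c v y| + #|A'|.
  rewrite (sum_set_split A R) (card_set_split A R).
  have l1 : #|[set y in A | R y]| * 2 <= \sum_(y in [set y in A | R y]) #|linkers c v y|.
    by apply: geq_sum_const => y; rewrite inE => /andP[/nA/lin/linkers_card].
  have l2 : #|[set y in A | ~~ R y]| * 3 <= \sum_(y in [set y in A | ~~ R y]) #|linkers c v y|.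
    apply: geq_sum_const => y; rewrite inE => /andP[/nA/lin/linkers_card]; rewrite /R; clear; lia.
  by move: l1 l2; rewrite /A'; clear; lia.
have S1 : \sum_(y in [set: colour]) #|linkers c v y| =
          \sum_(y in A) #|linkers c v y| + \sum_(y in ~: A) #|linkers c v y|.
  by rewrite (bigID (mem A)) /=; congr (_ + _); apply: eq_bigl => y; rewrite !inE.
have cA : #|A| + #|~: A| = 5 by rewrite cardsC card_ord.
have S2 : #|X'| <= 4 by rewrite -cX; apply: subset_leq_card; apply/subsetP => x; rewrite inE => /andP[].
have U2 : \sum_(x in X') #|seen c v x| <= #|X'| * 2.
  by apply: leq_sum_const => x; rewrite inE => /andP[].
(* If every colour has linkers, the incidences number at least [13 - #|A'|] and at most
   [12 - #|X'|], while [solo] gives [#|A'| <= #|X'|]. *)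
case: (boolP (linkers c v a != set0)) => La.
  have L2 : #|~: A| * 2 <= \sum_(y in ~: A) #|linkers c v y|.
    apply: geq_sum_const => y _; apply: linkers_card; case: (eqVneq y a) => [->//|]; exact: lin.
  by move: E1 E2 E3 U1 L1 S1 cA S2 U2 L2 A3; clear; lia.
have [|/forall_inPn[u un]] : linkers c v a != set0 \/ ~~ okc c v a.
- by apply: (crit_block opt cr); rewrite ma.
- by rewrite (negbTE La).
rewrite -ltnNge => u4.
have s0 : seen c v u = set0.
  apply/eqP; rewrite -subset0; apply/subsetP => y ys.
  have ya := full_seen cv (nb_adj un) u4 ys.
  have : u \in linkers c v a by rewrite -ya in_linkers (nb_adj un).
  by move: La; rewrite negbK => /eqP->; rewrite inE.
have uX' : u \in X' by rewrite inE un /P s0 cards0.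
(* Now [u] lies in [X'] and sees nothing, so [#|A'| <= #|X'| - 1]; the incidences number at most
   [10 - #|X'|] and at least [11 - #|A'|]. *)
have U3 : \sum_(x in X') #|seen c v x| <= (#|X'| - 1) * 2.
  rewrite (big_setD1 u) //= s0 cards0 add0n.
  have -> : #|X'| - 1 = #|X' :\ u| by rewrite (cardsD1 u X') uX' addKn.
  by apply: leq_sum_const => x; rewrite !inE => /and3P[].
have X1 : 0 < #|X'| by apply/card_gt0P; exists u.
have aA : a \in ~: A by rewrite in_setC inE ma.
have L2 : (#|~: A| - 1) * 2 <= \sum_(y in ~: A) #|linkers c v y|.
  rewrite (big_setD1 a) //=.
  have -> : #|~: A| - 1 = #|~: A :\ a| by rewrite (cardsD1 a (~: A)) aA addKn.
  apply: leq_trans (leq_addl _ _); apply: geq_sum_const => y.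
  by rewrite in_setD1 => /andP[/lin/linkers_card].
by move: E1 E2 E3 U1 L1 S1 cA S2 U3 L2 A3 X1; clear; lia.
Qed.

End Type4.

(** * Multiplicities (3,2) and (5) *)

Section Type5.
Variables (G : graph5) (h M0 : nat).
Hypothesis opt : optimal G h M0.
Implicit Types (v x z u : G) (p q y d : colour) (s : seq colour).
Local Notation crit := (@crit G h).
Local Notation okQ := (@okQ G M0).

Section Config.
Variables (c : colouring G) (v : G) (a b : colour).
Hypotheses (cr : crit c v) (nab : a != b) (ma : mdeg c v a = 3) (mb : mdeg c v b = 2).
Hypothesis mo : mono c <= M0.
Local Notation X := (nb c v a).
Local Notation Y := (nb c v b).
Local Notation L := (linkers c v).

Let gc : good c. Proof. by have [] := cr. Qed.
Let cv : c v = None. Proof. by have [] := cr. Qed.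

Lemma triple_pair_absent y : y != a -> y != b -> mdeg c v y = 0.
Proof.
move=> na nb'; have us : uniq [:: a; b; y] by rewrite /= !inE negb_or nab (eq_sym a y) (eq_sym b y) na nb'.
have := @sum_mdeg _ c v [:: a; b; y] set0 us; rewrite cards0 !big_cons big_nil !addn0 ma mb => H.
have : 3 + (2 + mdeg c v y) <= 5 by apply: H => z; rewrite inE.
by clear; lia.
Qed.

Lemma triple_pair_le3 y : mdeg c v y <= 3.
Proof.
case: (eqVneq y a) => [->|na]; first by rewrite ma.
by case: (eqVneq y b) => [->|nb']; [rewrite mb|rewrite triple_pair_absent].
Qed.

Lemma triple_pair_class y x : x \in L y -> x \in X \/ x \in Y.
Proof.
move=> xk; have [p cx] : exists p, c x = Some p by have := seen_linkers xk => /seen_coloured.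
have xn : x \in nb c v p by rewrite in_nb cx eqxx andbT; move: xk; rewrite in_linkers => /andP[].
case: (eqVneq p a) => [<-|na]; first by left.
case: (eqVneq p b) => [<-|nb']; first by right.
by move/eqP: (triple_pair_absent na nb'); rewrite cards_eq0 => /eqP E; rewrite E inE in xn.
Qed.

Lemma triple_pair_disj x : x \in X -> x \notin Y.
Proof. by rewrite !in_nb => /andP[_ /eqP->]; rewrite negb_and; apply/orP; right. Qed.

(** Recolouring a vertex of [X] leads to (2,2,1), one of [Y] to (3,1,1); both tolerate the slack. *)
Lemma triple_pair_free x : x \in X \/ x \in Y -> #|seen c v x| <= 3 /\ (#|seen c v x| = 3 -> dcol c x = seen c v x).
Proof.
move=> xn; have [p cx vx] : exists2 p, c x = Some p & adj v x.
  by case: xn => /[dup] /nb_col ? /nb_adj; [exists a|exists b].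
have Z3 : 3 <= #|~: [set a; b]| by have := cardsC [set a; b]; rewrite cards2 nab card_ord; clear; lia.
apply: (rainbow_free cv vx Z3) => d; rewrite in_setC in_set2 negb_or => /andP[da db] rb H.
have d0 := triple_pair_absent da db.
have npd : p != d by case: xn => /nb_col; rewrite cx => -[->]; rewrite eq_sym.
have md y := recol_mdeg d cx v y; rewrite vx /= in md.
have crd := crit_recol cr cx vx npd rb H.
have mod : mono (upd c x (Some d)) <= M0 + 5.
  by have := recol_mono d cx rb; move: mo; clear; lia.
case: xn => xn; have := nb_col xn; rewrite cx => -[pE].
- rewrite pE in md; apply: (two_pairs_absurd opt crd (a := a) (b := b)); last by right.
  split => //.
  + by have := md a; rewrite eqxx ma (negbTE da) addn0 addn1 => -[].
  + by have := md b; rewrite mb (negbTE nab) (negbTE db) !addn0.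
  + move=> q na nb'; have := md q; rewrite triple_pair_absent // eq_sym (negbTE na) addn0 => ->.
    by case: (_ == _).
- rewrite pE in md; apply: (triple_absurd (a := a) opt crd); last by right.
  + by have := md a; rewrite ma [b == a]eq_sym (negbTE nab) (negbTE da) !addn0.
  + move=> q na; case: (eqVneq q b) => [->|nb'].
      by have := md b; rewrite mb eqxx (negbTE db) addn0 addn1 => -[->].
    have := md q; rewrite triple_pair_absent // eq_sym (negbTE nb') addn0 => ->.
    by case: (_ == _).
Qed.

Lemma triple_pair_lin y : y != a -> y != b -> L y != set0.
Proof.
move=> na nb'; have m0 := triple_pair_absent na nb'.
by case: (crit_block (y := y) opt cr); rewrite ?m0 // absent_okc.
Qed.

Lemma triple_pair_shift x y : x \in L y -> #|L y| = 2 -> okc c v y -> crit (shift c v x y) x.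
Proof.
move=> xk k2 ok; have [p cx] : exists p, c x = Some p by have := seen_linkers xk => /seen_coloured.
have vx : adj v x by move: xk; rewrite in_linkers => /andP[].
apply: (crit_shift cr cx vx).
- by move: k2; rewrite (cardsD1 x) xk; clear; lia.
- by move=> z vz cz _; apply: (okcP _ _ _ ok).
- by have := triple_pair_le3 y; clear; lia.
Qed.

Lemma triple_pair_solo x y : x \in L y -> #|L y| = 2 -> okc c v y -> #|seen c v x| <= 2.
Proof.
move=> xk k2 ok; have [s3 E] := triple_pair_free (triple_pair_class xk).
rewrite leq_eqVlt in s3; case/orP: s3 => [/eqP s3|//].
have vx : adj v x by move: xk; rewrite in_linkers => /andP[].
by case: (shift_three_seen_absurd opt cr vx (E s3) s3 (seen_linkers xk) (triple_pair_shift xk k2 ok)).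
Qed.

Section WithU.
Variable u : G.
Hypothesis un : u \in Y.
Local Notation B := (seen c v u).

Lemma triple_pair_LY y w : w \in Y -> (w \in L y) = (y \in B).
Proof. by move=> wn; rewrite in_linkers (nb_adj wn) (class2_seen mb wn un). Qed.

Lemma triple_pair_LX y : y \notin B -> L y \subset X.
Proof. by move=> yB; apply/subsetP => x xk; case: (triple_pair_class xk) => // xY; move: yB; rewrite -(triple_pair_LY y xY) xk. Qed.

Lemma triple_pair_LB y : y \in B -> #|L y| = 2 + #|L y :&: X|.
Proof.
move=> yB; rewrite -(cardsID X (L y)) addnC; congr (_ + _).
rewrite -[RHS]mb /mdeg; apply: eq_card => w; rewrite in_setD.
case: (boolP (w \in Y)) => wY; first by rewrite triple_pair_LY // yB andbT; apply: contraTN wY => /triple_pair_disj.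
by apply/negbTE; rewrite negb_and negbK; case: (boolP (w \in L y)) => [/triple_pair_class[->|wY']|]; rewrite ?orbT //; rewrite wY' in wY.
Qed.

(** Obstructions for [V] end in [X] only. Their incidences number at least [3 * #|V| - #|V'|], and
    those of [X] at most [9 - #|X'|], with [#|V'| <= #|X'|]. For [#|V| = 3] every estimate is
    tight. *)
Lemma triple_pair_count (V : {set colour}) :
  (forall y, y \in V -> [/\ y \notin B, L y != set0 & okc c v y]) ->
  #|V| <= 3 /\ (#|V| = 3 -> forall x, x \in X -> seen c v x \subset V /\
    (#|seen c v x| = 3 \/ (#|seen c v x| = 2 /\ forall y, y \in seen c v x -> #|L y| = 2))).
Proof.
move=> HV.
pose P (x : G) := #|seen c v x| <= 2.
pose X' := [set x in X | P x].
pose R (y : colour) := #|L y| == 2.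
pose V' := [set y in V | R y].
have HX x : x \in X -> adj v x by apply: nb_adj.
have LX y : y \in V -> L y :&: X = L y by case/HV => /triple_pair_LX /setIidPl.
have cX : #|X| = 3 by exact: ma.
have E1 : \sum_(x in X) #|seen c v x :&: V| = \sum_(y in V) #|L y|.
  by rewrite double_count //; apply: eq_bigr => y /LX->.
have E1' : \sum_(x in X) #|seen c v x| = \sum_(x in X) #|seen c v x :&: V| + \sum_(x in X) #|seen c v x :\: V|.
  by rewrite -big_split /=; apply: eq_bigr => x _; rewrite cardsID.
have E2 : \sum_(x in X') #|seen c v x :&: V'| = #|V'| * 2.
  rewrite double_count => [|x]; last by rewrite inE => /andP[/HX].
  rewrite -sum_nat_const; apply: eq_bigr => y; rewrite inE => /andP[yV /eqP k2].
  have [yB Ly ok] := HV _ yV.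
  rewrite (setIidPl _) //; apply/subsetP => x xk.
  by rewrite inE (subsetP (triple_pair_LX yB) _ xk) /P (triple_pair_solo xk).
have E3 : \sum_(x in X') #|seen c v x :&: V'| <= \sum_(x in X') #|seen c v x|.
  by apply: leq_sum => x _; apply: subset_leq_card; apply: subsetIl.
have X3 : #|X'| <= 3 by rewrite -cX; apply: subset_leq_card; apply/subsetP => x; rewrite inE => /andP[].
have U1 : \sum_(x in X) #|seen c v x| <= \sum_(x in X') #|seen c v x| + (3 - #|X'|) * 3.
  rewrite (sum_set_split X P) leq_add2l.
  have -> : 3 - #|X'| = #|[set x in X | ~~ P x]| by rewrite -cX (card_set_split X P) addKn.
  by apply: leq_sum_const => x; rewrite inE => /andP[xX _]; have [] := triple_pair_free (or_introl xX).
have L1 : #|V| * 3 <= \sum_(y in V) #|L y| + #|V'|.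
  rewrite (sum_set_split V R) (card_set_split V R).
  have l1 : #|[set y in V | R y]| * 2 <= \sum_(y in [set y in V | R y]) #|L y|.
    by apply: geq_sum_const => y; rewrite inE => /andP[/HV[_ /linkers_card]].
  have l2 : #|[set y in V | ~~ R y]| * 3 <= \sum_(y in [set y in V | ~~ R y]) #|L y|.
    apply: geq_sum_const => y; rewrite inE => /andP[/HV[_ /linkers_card]]; rewrite /R; clear; lia.
  by move: l1 l2; rewrite /V'; clear; lia.
have U2 : \sum_(x in X') #|seen c v x| <= #|X'| * 2.
  by apply: leq_sum_const => x; rewrite inE => /andP[].
split; first by move: E1 E1' E2 E3 X3 U1 L1 U2; clear; lia.
move=> V3 x xX.
have T0 : \sum_(x in X) #|seen c v x :\: V| = 0 /\ #|X'| * 2 <= \sum_(x in X') #|seen c v x :&: V'|.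
  by move: E1 E1' E2 E3 X3 U1 L1 U2; rewrite V3; clear; lia.
have [T0a T0b] := T0; split.
  by move: T0a => /eqP; rewrite (big_setD1 x) //= addn_eq0 => /andP[]; rewrite cards_eq0 setD_eq0.
have [s3 _] := triple_pair_free (or_introl xX).
case: (boolP (P x)) => Px; last by left; apply/eqP; rewrite eqn_leq s3 ltnNge.
right; have xX' : x \in X' by rewrite inE xX.
have l2 : 2 <= #|seen c v x :&: V'|.
  have : \sum_(w in X' :\ x) #|seen c v w :&: V'| <= #|X' :\ x| * 2.
    apply: leq_sum_const => z; rewrite !inE => /and3P[_ _ Pz].
    by apply: leq_trans Pz; apply: subset_leq_card; apply: subsetIl.
  by move: T0b; rewrite (big_setD1 x) //= (cardsD1 x X') xX'; clear; lia.
have s2 : #|seen c v x| = 2.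
  by apply/eqP; rewrite eqn_leq [X in X && _]Px; apply: leq_trans l2 _; apply: subset_leq_card; apply: subsetIl.
split => // y ys; have E : seen c v x :&: V' = seen c v x.
  by apply/eqP; rewrite eqEcard subsetIl s2.
by move: ys; rewrite -E !inE => /andP[_ /andP[_ /eqP]].
Qed.

Lemma triple_pair_full_X x0 y x : x0 \in X -> 4 <= mdeg c x0 a -> y != a -> y \notin B -> L y != set0 ->
  x \in X -> x != x0 -> x \in L y /\ #|L y| = 2.
Proof.
move=> x0n x04 na yB Ly xX nx.
have sub : L y \subset X :\ x0.
  apply/subsetP => w wk; rewrite in_setD1 (subsetP (triple_pair_LX yB) _ wk) andbT.
  apply: contra_neq na => wx; rewrite wx in wk; exact: full_seen cv (nb_adj x0n) x04 (seen_linkers wk).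
have c2 : #|X :\ x0| = 2 by have := ma; rewrite /mdeg (cardsD1 x0) x0n; clear; lia.
have E : L y = X :\ x0 by apply/eqP; rewrite eqEcard sub c2 linkers_card.
by rewrite E in_setD1 nx xX.
Qed.

Lemma triple_pair_two_X x0 : x0 \in X -> exists x1 x2, [/\ x1 \in X, x2 \in X, x1 != x0, x2 != x0 & x1 != x2].
Proof.
move=> x0n; have : 1 < #|X :\ x0| by have := ma; rewrite /mdeg (cardsD1 x0) x0n; clear; lia.
by case/card_gt1P => x1 [x2 []]; rewrite !in_setD1 => /andP[? ?] /andP[? ?] ?; exists x1, x2.
Qed.

(** If the [b]-pair is saturated it sees at most [b], and the three vertices of [X] would have to
    block four colours, or two of them three colours if the third is saturated. *)
Lemma triple_pair_okb : okc c v b.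
Proof.
case: (boolP (okc c v b)) => // /forall_inPn[w wn]; rewrite -ltnNge => w4.
have BE y : y != b -> y \notin B.
  rewrite (class2_seen mb un wn); apply: contra_neqN; exact: full_seen cv (nb_adj wn) w4.
case: (boolP (okc c v a)) => oka.
  have La : L a != set0 by case: (crit_block (y := a) opt cr); rewrite ?ma ?oka.
  have [] := @triple_pair_count (~: [set b]); last by rewrite cardsC1 card_ord.
  move=> y; rewrite in_setC1 => nb'; split; first exact: BE.
    by case: (eqVneq y a) => [->//|na]; apply: triple_pair_lin.
  by case: (eqVneq y a) => [->//|na]; apply: absent_okc; apply: triple_pair_absent.
case/forall_inPn: oka => x0 x0n; rewrite -ltnNge => x04.
have [x1 [_ [x1n _ n1 _ _]]] := triple_pair_two_X x0n.
have Z3 : 3 <= #|~: [set a; b]| by have := cardsC [set a; b]; rewrite cards2 nab card_ord; clear; lia.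
have Lz y : y \in ~: [set a; b] -> x1 \in L y /\ #|L y| = 2.
  rewrite in_setC in_set2 negb_or => /andP[na nb']; apply: (triple_pair_full_X x0n x04) => //; first exact: BE.
  exact: triple_pair_lin.
have s3 : 3 <= #|seen c v x1|.
  by apply: leq_trans Z3 _; apply: subset_leq_card; apply/subsetP => y /Lz[/seen_linkers].
have /card_gt0P[y yZ] : 0 < #|~: [set a; b]| by apply: leq_trans Z3.
have [h1 h2] := Lz y yZ; move: yZ; rewrite !inE negb_or => /andP[na nb'].
by have := triple_pair_solo h1 h2 (absent_okc (triple_pair_absent na nb')); rewrite leqNgt s3.
Qed.

Lemma triple_pair_Lb : L b != set0.
Proof. by case: (crit_block (y := b) opt cr); rewrite ?mb ?triple_pair_okb. Qed.

Lemma triple_pair_lin' y : y != a -> L y != set0 /\ okc c v y.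
Proof.
move=> na; case: (eqVneq y b) => [->|nb']; first by split; [apply: triple_pair_Lb|apply: triple_pair_okb].
by split; [apply: triple_pair_lin|apply: absent_okc; apply: triple_pair_absent].
Qed.

Lemma triple_pair_B3 : #|B| <= 3. Proof. by have [] := triple_pair_free (or_intror un). Qed.

Lemma triple_pair_B_solo y : y \in B -> #|B| = 3 -> okc c v y -> L y :&: X != set0.
Proof.
move=> yB B3 ok; apply/negP => /eqP E.
have uk : u \in L y by rewrite triple_pair_LY.
by have := triple_pair_solo uk; rewrite (triple_pair_LB yB) E cards0 B3 => /(_ erefl ok).
Qed.

(** A saturated [x0] in [X] leaves two active vertices there. Either they see too many colours, or
    the hole can move to [x0], against minimality of [mono]. *)
Lemma triple_pair_oka : okc c v a.
Proof.
case: (boolP (okc c v a)) => // /forall_inPn[x0 x0n]; rewrite -ltnNge => x04.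
have [x1 [x2 [n1 n2 nx1 nx2 n12]]] := triple_pair_two_X x0n.
have K y x : y != a -> y \notin B -> x \in X -> x != x0 -> y \in seen c v x /\ #|seen c v x| <= 2.
  move=> na yB xn nx; have [Ly ok] := triple_pair_lin' na.
  have [h1 h2] := triple_pair_full_X x0n x04 na yB Ly xn nx.
  by split; [apply: seen_linkers|apply: triple_pair_solo h1 h2 ok].
have sx0 y : y \in seen c v x0 -> y = a by apply: full_seen cv (nb_adj x0n) x04.
have B3 := triple_pair_B3.
case: (eqVneq #|B| 3) => [e3|n3].
  (* Linkers in [X] come in pairs avoiding [x0], so both other vertices of [X] are linkers for each
     of four colours. *)
  have S1 y : y != a -> y \in seen c v x1.
    move=> na; have [Ly ok] := triple_pair_lin' na.
    case: (boolP (y \in B)) => yB; last by have [] := K y x1 na yB n1 nx1.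
    have /set0Pn[w] := triple_pair_B_solo yB e3 ok; rewrite inE => /andP[wk wX].
    case: (eqVneq w x1) => [<-|nw1]; first exact: seen_linkers.
    have [w' [nw w'X w'k _]] := linkers_partner wk (nb_col wX).
    case: (eqVneq w' x1) => [<-|nw1']; first exact: seen_linkers.
    have : 3 < #|X|; last by rewrite -/(mdeg c v a) ma.
    have nk z : z \in L y -> z != x0.
      by move=> /seen_linkers; apply: contraTneq => ->; apply: contra_neqN na; apply: sx0.
    have us : uniq [:: x0; x1; w; w'].
      rewrite /= !inE !negb_or (eq_sym x0 x1) nx1 (eq_sym x0 w) (nk _ wk) (eq_sym x0 w') (nk _ w'k).
      by rewrite (eq_sym x1 w) nw1 (eq_sym x1 w') nw1' (eq_sym w w') nw.
    rewrite cardE; apply: (uniq_leq_size us) => z; rewrite mem_enum !in_cons in_nil orbF.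
    by case/or4P => /eqP->.
  have := triple_pair_free (or_introl n1) => -[s3 _].
  have : #|~: [set a]| <= #|seen c v x1|.
    by apply: subset_leq_card; apply/subsetP => y; rewrite in_setC1; apply: S1.
  by rewrite cardsC1 card_ord; move: s3; clear; lia.
have B2 : #|B| <= 2 by move: B3 n3; clear; lia.
have sub x : x \in X -> x != x0 -> ~: [set a] :\: B \subset seen c v x.
  move=> xn nx; apply/subsetP => y; rewrite in_setD in_setC1 => /andP[yB na].
  by have [] := K y x na yB xn nx.
have cC : #|~: [set a] :\: B| >= 2 + (a \in B).
  have := cardsID B (~: [set a]); rewrite cardsC1 card_ord => E.
  have : #|~: [set a] :&: B| + (a \in B) <= #|B|.
    rewrite (cardsD1 a B) addnC leq_add2l; apply: subset_leq_card; apply/subsetP => y.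
    by rewrite inE in_setC1 in_setD1.
  by move: E B2; rewrite (_ : 5.-1 = 4) //; clear; lia.
have s2 x : x \in X -> x != x0 -> #|seen c v x| <= 2.
  move=> xn nx; have /card_gt0P[y] : 0 < #|~: [set a] :\: B| by move: cC; clear; lia.
  by rewrite in_setD in_setC1 => /andP[yB na]; have [] := K y x na yB xn nx.
have E x : x \in X -> x != x0 -> seen c v x = ~: [set a] :\: B.
  move=> xn nx; apply/esym/eqP; rewrite eqEcard sub //; apply: leq_trans (s2 x xn nx) _.
  by move: cC; clear; lia.
have aB : a \notin B.
  by apply/negP => aB; have := s2 x1 n1 nx1; rewrite E // leqNgt; move: cC; rewrite aB => ->.
have La : L a = set0.
  apply/eqP/negPn/negP => /linkers_card.
  have : L a \subset [set x0].
    apply/subsetP => w wk; rewrite inE; apply/negPn/negP => nw.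
    by have := seen_linkers wk; rewrite E ?(subsetP (triple_pair_LX aB)) // in_setD in_setC1 eqxx andbF.
  by move/subset_leq_card; rewrite cards1; clear; lia.
have cx := nb_col x0n; have vx := nb_adj x0n.
have cr' : crit (shift c v x0 a) x0.
  apply: (crit_shift cr cx vx); first by rewrite La set0D cards0.
    move=> z vz cz nz; have zn : z \in X by rewrite in_nb vz cz eqxx.
    rewrite leqNgt; apply/negP => z4.
    have : 0 < #|~: [set a] :\: B| by move: cC; clear; lia.
    rewrite -(E z zn nz) => /card_gt0P[y ys].
    have ya := full_seen cv vz z4 ys.
    by move: ys; rewrite E // ya in_setD in_setC1 eqxx andbF.
  by rewrite ma.
(* The move loses at least four monochromatic edges at [x0] and creates two at [v], so [mono] drops
   by at least 4. *)
have [g' _ h'] := cr'; have := opt.2 _ g' h'.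
have := shift_mono a cv cx vx; rewrite ma eqxx; move: x04 mo; clear; lia.
Qed.

Lemma triple_pair_config_u : #|B| = 2 /\
  (forall x, x \in X -> #|seen c v x| = 3 \/ (#|seen c v x| = 2 /\ forall y, y \in seen c v x -> crit (shift c v x y) x)) /\
  (forall y, y \in B -> crit (shift c v u y) u).
Proof.
have ok y : okc c v y.
  by case: (eqVneq y a) => [->|na]; [apply: triple_pair_oka|have [] := triple_pair_lin' na].
have lin y : L y != set0.
  case: (eqVneq y a) => [->|na]; last by have [] := triple_pair_lin' na.
  by case: (crit_block (y := a) opt cr); rewrite ?ma ?ok.
have [|C1 C2] := @triple_pair_count (~: B); first by move=> y; rewrite in_setC => yB; split.
have C1' : #|~: B| <= 3 := C1.
have cB := cardsC B; rewrite card_ord in cB.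
have B3 := triple_pair_B3.
(* If [B] had three elements, each of the five colours would have two linkers in [X]: ten incidences
   against at most nine. *)
have B2 : #|B| = 2.
  case: (eqVneq #|B| 3) => [e3|n3]; last by move: C1' cB B3 n3; clear; lia.
  have : \sum_(x in X) #|seen c v x| <= #|X| * 3.
    by apply: leq_sum_const => x xn; have [] := triple_pair_free (or_introl xn).
  have : #|[set: colour]| * 2 <= \sum_(y in [set: colour]) #|L y :&: X|.
    apply: geq_sum_const => y _; case: (boolP (y \in B)) => yB; last first.
      by rewrite (setIidPl (triple_pair_LX yB)) linkers_card.
    have /set0Pn[w] := triple_pair_B_solo yB e3 (ok y); rewrite inE => /andP[wk wX].
    have [w' [nw w'X w'k _]] := linkers_partner wk (nb_col wX).
    by apply/card_gt1P; exists w', w; split => //; apply/setIP.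
  rewrite -double_count; last by move=> x; apply: nb_adj.
  rewrite (eq_bigr (fun x => #|seen c v x|)); last by move=> x _; rewrite setIT.
  by rewrite cardsT card_ord -/(mdeg c v a) ma => h1 h2; have := leq_trans h1 h2.
have cV : #|~: B| = 3 by move: cB; rewrite B2; clear; lia.
split => //; split.
  move=> x xn; have [_ [|[s2 sol]]] := C2 cV x xn; first by left.
  right; split => // y ys; apply: triple_pair_shift; rewrite ?sol ?ok //.
  by rewrite in_linkers (nb_adj xn).
move=> y yB; apply: triple_pair_shift; rewrite ?ok ?triple_pair_LY // (triple_pair_LB yB).
have -> : L y :&: X = set0; last by rewrite cards0.
apply/eqP; rewrite -subset0; apply/subsetP => w /setIP[wk wX].
have [sV _] := C2 cV w wX; have := subsetP sV _ (seen_linkers wk).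
by rewrite in_setC yB.
Qed.

End WithU.
End Config.
End Type5.

(** * Excluding (3,2), and preparations for (5) *)

Section Type56.
Variables (G : graph5) (h M0 : nat).
Hypothesis opt : optimal G h M0.
Implicit Types (c : colouring G) (v x z u : G) (p q y d a b : colour) (s : seq colour).
Local Notation crit := (@crit G h).
Local Notation okQ := (@okQ G M0).

Lemma sum_mdeg3 c x a b d : a != b -> a != d -> b != d -> mdeg c x a + mdeg c x b + mdeg c x d <= 5.
Proof.
move=> nab nad nbd; have us : uniq [:: a; b; d] by rewrite /= !inE negb_or nab nad nbd.
have := @sum_mdeg _ c x [:: a; b; d] set0 us; rewrite cards0 !big_cons big_nil !addn0 addnA => H.
by apply: H => z; rewrite inE.
Qed.

Lemma crit_large c v : crit c v -> mono c <= M0 ->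
  (exists a b, [/\ a != b, mdeg c v a = 3 & mdeg c v b = 2]) \/ exists a, mdeg c v a = 5.
Proof.
move=> cr mo.
have Q s k : okQ c v s k by right; move: mo; clear; lia.
case: (@arg_maxnP _ ord0 predT (mdeg c v) isT) => a _ amax.
have m2 b : b != a -> mdeg c v a + mdeg c v b <= 5 by move=> nb'; apply: sum_mdeg2; rewrite eq_sym.
case: (boolP [forall b, (b != a) ==> (mdeg c v b <= 1)]) => [/forallP H|/forallPn[b]].
  have m1 b : b != a -> mdeg c v b <= 1 by move=> nb'; have := H b; rewrite nb'.
  case E: (mdeg c v a) => [|[|[|[|[|[|n]]]]]].
  - by case: (pair_absurd (a := a) opt cr); rewrite ?E.
  - by case: (pair_absurd (a := a) opt cr); rewrite ?E.
  - by case: (pair_absurd (a := a) opt cr); rewrite ?E.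
  - by case: (triple_absurd (a := a) opt cr); rewrite ?E.
  - by case: (quadruple_absurd (a := a) opt cr); rewrite ?E.
  - by right; exists a.
  - have := sum_mdeg_all c v; rewrite (bigD1 a) //= E => K.
    by exfalso; move: K; clear; lia.
rewrite negb_imply -ltnNge => /andP[nb' b2].
have := m2 b nb'; have := amax b isT; move: b2 => b2 h1 h2.
case: (eqVneq (mdeg c v a) 3) => [a3|n3].
  left; exists a, b; split => //; first by rewrite eq_sym.
  by move: b2 h1 h2; rewrite a3; clear; lia.
have [a2 b2'] : mdeg c v a = 2 /\ mdeg c v b = 2 by move: b2 h1 h2 n3; clear; lia.
case: (two_pairs_absurd opt cr (a := a) (b := b)) => //; split => //; first by rewrite eq_sym.
move=> p pa pb; have := @sum_mdeg3 c v a b p; rewrite a2 b2' eq_sym nb' eq_sym pa eq_sym pb.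
by move=> /(_ isT isT isT); clear; lia.
Qed.

(** The hole moves to a [b]-neighbour [u] and back; in effect [u] turns from [b] to [a], which makes
    the type (4,1). *)
Lemma triple_pair_absurd c v a b : crit c v -> mono c <= M0 -> a != b -> mdeg c v a = 3 -> mdeg c v b = 2 -> False.
Proof.
move=> cr mo nab ma mb; have [gc cv hc] := cr.
have /card_gt0P[u un] : 0 < mdeg c v b by rewrite mb.
have [B2 [_ CU]] := triple_pair_config_u opt cr nab ma mb mo un.
have okb := triple_pair_okb opt cr nab ma mb mo un.
have cu := nb_col un; have vu := nb_adj un.
(* Avoiding [a] keeps [mono] minimal: [m] is absent around [v], or it equals [b] and [u] has a
   neighbour of its own colour. *)
have [m ms nma] : exists2 m, m \in seen c v u & m != a.
  have : 0 < #|seen c v u :\ a| by have := B2; rewrite (cardsD1 a); case: (a \in _); clear; lia.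
  by case/card_gt0P => m; rewrite in_setD1 => /andP[? ?]; exists m.
have cr1 := CU m ms; set c1 := shift c v u m in cr1.
have mo1 : mono c1 <= M0.
  have := shift_mono m cv cu vu; rewrite -/c1.
  case: (eqVneq b m) => [bm|nbm].
    have : b \in dcol c u by rewrite bm (subsetP (seen_dcol c v u)).
    by rewrite inE -bm mb; move: mo; clear; lia.
  have -> : mdeg c v m = 0 by apply: (triple_pair_absent nab ma mb); rewrite // eq_sym.
  by move: mo; clear; lia.
have md1 y := shift_mdeg_new m cv cu vu y; rewrite -/c1 in md1.
have mm : 0 < mdeg c1 u m by rewrite md1 eqxx addn1.
have D2 : 1 < #|dcol c u| := leq_trans (eq_leq (esym B2)) (subset_leq_card (seen_dcol c v u)).
have vn y : mdeg c1 v y + (b == y) = mdeg c v y.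
  by have := shift_mdeg m cv cu vu v y; rewrite -/c1 vu adjxx addn0.
have dv : dcol c1 v = [set a; b].
  apply/setP => y; rewrite !inE; case: (eqVneq y a) => [->|na] /=.
    by have := vn a; rewrite eq_sym (negbTE nab) addn0 ma => ->.
  case: (eqVneq y b) => [->|nb'].
    by have := vn b; rewrite eqxx mb addn1 => -[->].
  have := vn y; rewrite eq_sym (negbTE nb') addn0 => ->.
  by rewrite (triple_pair_absent nab ma mb).
have uv : adj u v by rewrite adjC.
have c1v : c1 v = Some m by apply: shift_at.
have seen2 : #|seen c1 u v| = 2 -> a \in seen c1 u v.
  move=> s2; have -> : seen c1 u v = [set a; b]; last by rewrite !inE eqxx.
  by apply/eqP; rewrite eqEcard -dv seen_dcol dv s2 cards2 nab.
have [_ hu _] := cr1.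
(* the hole can be moved back to v while u receives colour a *)
have fin : crit (shift c1 u v a) v -> False.
  move=> cr2; have md2 y := shift_mdeg_new a hu c1v uv y.
  apply: (quadruple_absurd (a := a) opt cr2).
    by rewrite md2 eqxx; have := vn a; rewrite eq_sym (negbTE nab) addn0 ma => ->.
  left => y; rewrite inE => nya; case: (eqVneq y b) => [->|nyb]; last first.
    apply: absent_okc; rewrite md2 eq_sym (negbTE nya) addn0.
    have := vn y; rewrite eq_sym (negbTE nyb) addn0 => ->.
    by rewrite (triple_pair_absent nab ma mb).
  apply/okcP => z vz cz.
  have nzv : z != v := adj_neq vz.
  have nzu : z != u.
    by apply: contra_eq_neq cz => ->; rewrite shift_at; apply: contra_neq nab => -[].
  have cz0 : c z = Some b by move: cz; rewrite shift_other // /c1 shift_other.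
  have := okcP _ _ _ okb z vz cz0.
  have := shift_mdeg a hu c1v uv z b; have := shift_mdeg m cv cu vu z b; rewrite -/c1.
  by rewrite (negbTE nab) andbF; clear; lia.
case: (crit_large cr1 mo1) => [[a' [b' [nab' ma' mb']]]|[a' ma']]; last first.
  have [w wD nw] : exists2 w, w \in dcol c u & w != a'.
    have : 0 < #|dcol c u :\ a'| by move: D2; rewrite (cardsD1 a'); case: (a' \in _); clear; lia.
    by case/card_gt0P => w; rewrite in_setD1 => /andP[? ?]; exists w.
  have := @sum_mdeg2 _ c1 u w a' nw; rewrite ma'; have := md1 w; move: wD; rewrite inE; clear; lia.
have /card_gt0P[w wn] : 0 < mdeg c1 u b' by rewrite mb'.
have [B2' [CX' _]] := triple_pair_config_u opt cr1 nab' ma' mb' mo1 wn.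
have vn' : v \in nb c1 u m by rewrite in_nb uv c1v eqxx.
have [ma''|mb''] : m = a' \/ m = b'.
  case: (eqVneq m a') => [|na']; first by left.
  case: (eqVneq m b') => [|nb']; first by right.
  by have := @sum_mdeg3 c1 u a' b' m nab'; rewrite eq_sym na' eq_sym nb' ma' mb' => /(_ isT isT); move: mm; clear; lia.
- rewrite ma'' in vn'; have [s3|[s2 sh]] := CX' v vn'.
    have := subset_leq_card (seen_dcol c1 u v); rewrite s3 dv cards2; by case: (_ != _).
  by apply: fin; apply: sh; apply: seen2.
- rewrite mb'' in vn'; have [s2 [_ sh]] := triple_pair_config_u opt cr1 nab' ma' mb' mo1 vn'.
  by apply: fin; apply: sh; apply: seen2.
Qed.

Lemma crit_mono5 c v : crit c v -> mono c <= M0 -> exists a, mdeg c v a = 5.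
Proof.
move=> cr mo; case: (crit_large cr mo) => // -[a [b [nab ma mb]]].
by case: (triple_pair_absurd cr mo nab ma mb).
Qed.

(** The argument for (3,1,1) without optimality, for use on colourings with one hole more than the
    minimum. It records which vertex is recoloured, so that its effect on other vertices can be
    traced. *)
Lemma triple_extend c v a : good c -> c v = None -> mdeg c v a = 3 -> (forall p, p != a -> mdeg c v p <= 1) ->
  (forall y, y != a -> okc c v y) ->
  (exists y, good (upd c v (Some y))) \/
  exists g d y, [/\ g \in nb c v a, 4 <= #|dcol c g| & good (upd (upd c g (Some d)) v (Some y))].
Proof.
move=> gc cv ma m1 ok; case: (classic (exists y, good (upd c v (Some y)))) => [|nf]; first by left.
right.
have blk c' y : good c' -> c' v = None -> ~ good (upd c' v (Some y)) -> mdeg c' v y <= 4 ->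
    linkers c' v y != set0 \/ ~~ okc c' v y.
  move=> gc' cv' ng m4; case: eqP => L0; last by left.
  by right; apply/negP => ok'; apply: ng; apply: good_fill.
have ng y : ~ good (upd c v (Some y)) by move=> g; apply: nf; exists y.
have [||x xn s4] := triple_blocked cv ma m1.
- move=> y ny; case: (blk c y gc cv (ng y)) => //; first by apply: leq_trans (m1 y ny) _.
  by rewrite ok.
- by apply: blk => //; rewrite ma.
have vx := nb_adj xn; have cx := nb_col xn.
have d4 := leq_trans s4 (subset_leq_card (seen_dcol c v x)).
have rb := rainbow_card cv vx d4.
have [d /andP[ds d0]] : exists d, (d \in seen c v x) && (d \in [set y | mdeg c v y == 0]).
  apply: setI_exists; rewrite card_ord absent_card.
  have := sum_dcol c v [set a]; rewrite big_set1 (cardsD1 a (dcol c v)) inE ma.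
  by have := sum_mdeg_all c v; move: s4; clear; lia.
rewrite inE in d0; move/eqP in d0.
have nad : a != d by apply: contra_eq_neq ma => ->; rewrite d0.
case: (classic (exists y, good (upd (upd c x (Some d)) v (Some y)))) => [[y g]|nf'].
  by exists x, d, y.
have gc' : good (upd c x (Some d)) by apply: (recol_good cx rb vx nad gc); rewrite ds.
have cv' : upd c x (Some d) v = None by apply: recol_hole.
have ng' y : ~ good (upd (upd c x (Some d)) v (Some y)) by move=> g; apply: nf'; exists y.
have md y := recol_mdeg d cx v y; rewrite vx /= in md.
have ma' : mdeg (upd c x (Some d)) v a <= 2.
  by have := md a; rewrite eqxx ma [d == a]eq_sym (negbTE nad); clear; lia.
have m1' q : q != a -> mdeg (upd c x (Some d)) v q <= 1.
  move=> nq; have := md q; rewrite [a == q]eq_sym (negbTE nq) addn0 => ->.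
  by case: (eqVneq d q) => [<-|_]; [rewrite d0|rewrite addn0; apply: m1].
case: (pair_unblocked cv' ma' m1').
  move=> y ny; case: (blk _ y gc' cv' (ng' y)) => //; first by apply: leq_trans (m1' y ny) _.
  by rewrite (recol_okc cv cx) // ok.
by apply: blk => //; apply: leq_trans ma' _.
Qed.

(** * All five neighbours of the hole in one colour *)

Section Five.
Variables (c : colouring G) (v : G) (a : colour).
Hypotheses (cr : crit c v) (mo : mono c <= M0) (ma : mdeg c v a = 5).
Let gc : good c. Proof. by have [] := cr. Qed.
Let cv : c v = None. Proof. by have [] := cr. Qed.
Let hc : holes c = h. Proof. by have [] := cr. Qed.

Lemma five_col z : adj v z -> c z = Some a.
Proof.
move=> vz; have sub : nb c v a \subset [set z | adj v z].
  by apply/subsetP => w; rewrite !inE => /andP[].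
have E : nb c v a = [set z | adj v z].
  by apply/eqP; rewrite eqEcard sub /= -/(mdeg c v a) ma adj_deg.
by have : z \in nb c v a; [rewrite E inE|move/nb_col].
Qed.

Lemma five_absent y : y != a -> mdeg c v y = 0.
Proof. by move=> ny; have := @sum_mdeg2 _ c v y a ny; rewrite ma; clear; lia. Qed.

(** Changing the colour of a single neighbour of [v] yields type (4,1), and the bound on
    [mdeg c' x d] gives [okc]. *)
Lemma five_one c' x d : crit c' v -> adj v x -> c' x = Some d -> d != a -> mdeg c' x d <= 3 ->
  (forall z, adj v z -> z != x -> c' z = Some a) -> False.
Proof.
move=> cr' vx cx nda m3 H; apply: (quadruple_absurd (a := a) opt cr').
  have E : nb c' v a = nb c v a :\ x.
    apply/setP => z; rewrite in_setD1 !in_nb; case: (boolP (adj v z)) => vz; last by rewrite andbF.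
    rewrite five_col // eqxx; case: (eqVneq z x) => [->|nz]; last by rewrite H ?eqxx.
    by rewrite cx; apply/negbTE; apply: contra nda.
  have := ma; rewrite {1}/mdeg (cardsD1 x) in_nb vx five_col // eqxx /mdeg E; clear; lia.
left => y; rewrite inE => ny; apply/okcP => z vz cz.
case: (eqVneq z x) cz => [->|nz]; first by rewrite cx => -[<-].
by rewrite H // => -[ay]; rewrite ay eqxx in ny.
Qed.

Lemma five_recol x d : adj v x -> d != a -> mdeg c x d <= 3 -> good (upd c x (Some d)) -> False.
Proof.
move=> vx nda m3 g; have cx := five_col vx.
apply: (@five_one (upd c x (Some d)) x d) => //.
- split => //; first exact: recol_hole.
  by rewrite (recol_holes d cx).
- exact: upd_same.
- by have := recol_mdeg d cx x d; rewrite adjxx /= !addn0 => ->.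
- by move=> z vz nz; rewrite upd_other // five_col.
Qed.

Lemma five_rainbow x d : adj v x -> (forall y, mdeg c x y <= 1) -> d != a ->
  (d \in seen c v x) || (d \notin dcol c x) -> False.
Proof.
move=> vx rb nda H; apply: (five_recol vx nda); first by apply: leq_trans (rb d) _.
by apply: (recol_good (five_col vx) rb vx _ gc H); rewrite eq_sym.
Qed.

(* If recolouring [x] is obstructed by the pair [w], [w2], then either [w] can be recoloured, making
   the neighbours of [x] distinct, or [w] becomes a hole of type (3,1,1) once [x] is recoloured. *)
Section W.
Variables (x : G) (p : colour).
Hypotheses (vx : adj v x) (E : dcol c x = seen c v x) (s3 : #|seen c v x| = 3)
  (na : a \notin dcol c x) (dp : dup c x p).
Let cx : c x = Some a. Proof. exact: five_col. Qed.
Let c0 := upd c x None.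
Let g0 : good c0. Proof. exact: good_unc. Qed.
Let hx : c0 x = None. Proof. exact: upd_same. Qed.
Let npa : p != a.
Proof. by apply: contraNneq na => <-; rewrite inE; have [-> _] := dp. Qed.
Let nbp : nb c0 x p = nb c x p.
Proof.
apply/setP => z; rewrite !in_nb updE; case: (eqVneq z x) => // ->.
by rewrite adjxx.
Qed.

Lemma W_m y : mdeg c0 x y = mdeg c x y. Proof. exact: mdeg_unc_self. Qed.

Lemma W_le1 y : y != p -> mdeg c0 x y <= 1.
Proof. by rewrite W_m; have [_ H] := dp; apply: H. Qed.

Lemma W_ok d : d != a -> d != p -> okc c0 x d.
Proof.
move=> da ddp; apply: (seen_unc_ok (v := v) cx); rewrite 1?eq_sym //.
- by have := W_le1 ddp; rewrite W_m.
- by rewrite -E orbN.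
Qed.

(** Recolouring [x] with [d] must be blocked by a cycle, and the two [p]-neighbours are the only
    equally coloured neighbours of [x]. *)
Lemma W_seen w d : w \in nb c x p -> d != a -> d != p -> d \in seen c0 x w.
Proof.
move=> wn da ddp; apply: seen_linkers.
have L0 : linkers c0 x d != set0.
  apply/negP => /eqP L0; apply: (five_recol vx da); first by have := W_le1 ddp; rewrite W_m; clear; lia.
  rewrite -(upd_upd c x None); apply: good_fill => //; first exact: W_ok.
  by apply: leq_trans (W_le1 ddp) _.
have -> : linkers c0 x d = nb c x p; last by [].
apply/eqP; rewrite -nbp eqEcard (linkers_class _ W_le1) /= nbp -/(mdeg c x p).
by have [-> _] := dp; apply: linkers_card.
Qed.

Lemma W_final c' t : good c' -> c' v = None -> holes c' = h -> c' x = Some t -> t != a -> mdeg c' x t <= 3 ->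
  (forall z, adj v z -> z != x -> c' z = Some a) -> False.
Proof. by move=> g' v' h' x' ta m' H; apply: (@five_one c' x t). Qed.

Lemma W_absurd : False.
Proof.
have [p2 m1] := dp.
have /card_gt1P[w [w2 [wn wn2 nww]]] : 1 < #|nb c x p| by rewrite -/(mdeg c x p) p2.
have xw := nb_adj wn; have xw2 := nb_adj wn2.
have ncw z : z \in nb c x p -> ~~ adj v z.
  move=> zn; apply/negP => /five_col; rewrite (nb_col zn) => -[pa].
  by move: npa; rewrite pa eqxx.
have nwx := adj_neq xw; have nw2x := adj_neq xw2.
have cw0 : c0 w = Some p by rewrite upd_other // (nb_col wn).
have cw20 : c0 w2 = Some p by rewrite upd_other // (nb_col wn2).
have v0 : c0 v = None by rewrite upd_other // eq_sym; apply: adj_neq.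
have nvx : v != x by rewrite eq_sym; apply: adj_neq.
have nvw : v != w by apply: contra_eq_neq cv => ->; rewrite (nb_col wn).
have h0 : holes c0 = h.+1 by rewrite (holes_unc cx) hc.
have pD : p \in dcol c x by rewrite inE p2.
have oth z : adj v z -> z != x -> [/\ c0 z = Some a, z != w & z != w2].
  move=> vz nz; split; first by rewrite upd_other // five_col.
  - by apply: contraTneq vz => ->; apply: ncw.
  - by apply: contraTneq vz => ->; apply: ncw.
have [o [oa op oD]] : exists o, [/\ o != a, o != p & mdeg c x o = 0].
  have : 0 < #|~: (a |: dcol c x)|.
    have := cardsC (a |: dcol c x); rewrite card_ord cardsU1 na E s3; clear; lia.
  case/card_gt0P => o; rewrite in_setC in_setU1 negb_or => /andP[oa]; rewrite inE -eqn0Ngt => /eqP o0.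
  by exists o; split => //; apply: contra_eq_neq o0 => ->; rewrite p2.
have [q [qa qp qD]] : exists q, [/\ q != a, q != p & mdeg c x q = 1].
  have : 0 < #|dcol c x :\ p| by have := s3; rewrite -E (cardsD1 p) pD; clear; lia.
  case/card_gt0P => q; rewrite in_setD1 => /andP[qp qD]; exists q; split => //.
    by apply: contraNneq na => <-.
  by move: qD; rewrite inE => q0; apply/eqP; rewrite eqn_leq q0 m1.
have nsw : ~: [set a; p] \subset seen c0 x w.
  by apply/subsetP => d; rewrite in_setC in_set2 negb_or => /andP[da ddp]; apply: W_seen.
have cap : #|~: [set a; p]| = 3.
  by have := cardsC [set a; p]; rewrite cards2 eq_sym npa card_ord; clear; lia.
case: (boolP [forall y, mdeg c0 w y <= 1]) => [/forallP rb|/forallPn[t]].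
  (* w can be recoloured, which makes x rainbow *)
  pose c1 := upd c0 w (Some o).
  have os : o \in seen c0 x w by apply: W_seen.
  have npo : p != o by rewrite eq_sym.
  have g1 : good c1 by apply: (recol_good cw0 rb xw npo g0); rewrite os.
  have x1 : c1 x = None by apply: recol_hole.
  have md1 y : mdeg c1 x y + (p == y) = mdeg c x y + (o == y).
    by have := recol_mdeg o cw0 x y; rewrite xw W_m.
  have rb1 y : mdeg c1 x y <= 1.
    have := md1 y; case: (eqVneq p y) => [<-|npy]; first by rewrite p2 (negbTE op); clear; lia.
    case: (eqVneq o y) => [<-|noy]; first by rewrite oD; clear; lia.
    by have := m1 y; rewrite eq_sym npy => /(_ isT); clear; lia.
  have ok1 : okc c1 x q by apply: (recol_okc hx cw0) => //; [rewrite W_m|apply: W_ok].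
  have L1 : linkers c1 x q = set0.
    by have := @rainbow_linkers _ c1 x rb1 q; rewrite -x1 upd_id.
  have g2 := good_fill g1 x1 L1 ok1 (leq_trans (rb1 q) (isT : 1 <= 4)).
  apply: (@W_final (upd c1 x (Some q)) q) => //.
  - by rewrite upd_other // /c1 upd_other.
  - by have := holes_fill q x1; rewrite (recol_holes o cw0) h0 => -[].
  - exact: upd_same.
  - by rewrite mdeg_fill // adjxx addn0; have := rb1 q; clear; lia.
  - by move=> z vz nz; have [cz nzw _] := oth z vz nz; rewrite upd_other // /c1 upd_other.
rewrite -ltnNge => t2.
have tD : t \in dcol c0 w by rewrite inE; move: t2; clear; lia.
have t5 := mdeg_dcol hx xw tD.
have Ew : ~: [set a; p] = seen c0 x w.
  apply/eqP; rewrite eqEcard nsw cap; apply: leq_trans (subset_leq_card (seen_dcol c0 x w)) _.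
  by move: t5 t2; clear; lia.
have Dw : dcol c0 w = seen c0 x w.
  by apply/esym/eqP; rewrite eqEcard seen_dcol -Ew cap; move: t5 t2; clear; lia.
have sw3 : #|seen c0 x w| = 3 by rewrite -Ew.
have mt : mdeg c0 w t = 2 by move: t5 t2; rewrite Dw sw3; clear; lia.
have mt1 y : y != t -> mdeg c0 w y <= 1.
  move=> ny; have nty : t != y by rewrite eq_sym.
  have := sum_dcol2 c0 w nty; have := sum_mdeg_hole hx xw; rewrite Dw sw3 mt; clear; lia.
have [ta tp] : t != a /\ t != p.
  by move: tD; rewrite Dw -Ew in_setC in_set2 negb_or => /andP[].
have Lt : linkers c0 x t \subset nb c0 x p := linkers_class t W_le1.
(* Here [x] takes its final colour [t]; [w] becomes a hole of type (3,1,1), and [v] remains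
   uncoloured. *)
pose c4 := shift c0 x w t.
have g4 : good c4.
  apply: (shift_good hx cw0 xw g0).
  - have := subset_leq_card (setSD [set w] Lt); rewrite nbp => H; apply: leq_trans H _.
    by have := p2; rewrite /mdeg (cardsD1 w) wn; clear; lia.
  - by move=> z xz cz _; apply: (okcP _ _ _ (W_ok ta tp)).
  - by have := W_le1 tp; clear; lia.
have w4 : c4 w = None by apply: shift_hole.
have x4 : c4 x = Some t by apply: shift_at.
have md4 y := shift_mdeg_new t hx cw0 xw y; rewrite -/c4 in md4.
have h4 : holes c4 = h.+1 by rewrite (shift_holes t hx cw0 xw).
have v4 : c4 v = None by rewrite /c4 shift_other.
have w24 : c4 w2 = Some p by rewrite /c4 shift_other // eq_sym.
have ok4 y : y != t -> okc c4 w y.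
  move=> ny; apply: (shift_okc (s := [:: t]) g0 hx cw0 xw Dw); rewrite ?inE //.
  by move=> y'; rewrite inE; apply: mt1.
(* Two neighbours of [x], the hole [v] and [w2], are not coloured [t]. *)
have m3 c' : c' v = None -> c' w2 = Some p -> mdeg c' x t <= 3.
  move=> v' w2'; apply: (@mdeg_le_of2 _ _ _ _ v w2); rewrite ?v' ?w2' //.
  - by apply: contra_eq_neq cv => ->; rewrite (nb_col wn2).
  - by rewrite adjC.
  - by apply: contra_neq tp => -[].
have oth4 z : adj v z -> z != x -> c4 z = Some a.
  by move=> vz nz; have [cz nzw _] := oth z vz nz; rewrite /c4 shift_other.
have [||[y g5]|[g [d [y [gn g4d g5]]]]] := triple_extend g4 w4 _ _ ok4.
- by rewrite md4 eqxx mt.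
- by move=> y ny; rewrite md4 eq_sym (negbTE ny) addn0 mt1.
- have v5 : upd c4 w (Some y) v = None by rewrite upd_other.
  have w25 : upd c4 w (Some y) w2 = Some p by rewrite upd_other // eq_sym.
  apply: (W_final g5 v5 _ _ ta (m3 _ v5 w25)).
  + by have := holes_fill y w4; rewrite h4 => -[].
  + by rewrite upd_other // eq_sym.
  + by move=> z vz nz; have [_ nzw _] := oth z vz nz; rewrite upd_other // oth4.
have cg := nb_col gn; have wg := nb_adj gn.
(* In [c4] both [v] and [w] are uncoloured neighbours of [x], so [x] cannot have four colours around
   it. *)
have ngx : g != x.
  apply: contraTneq g4d => ->; rewrite -ltnNge ltnS.
  have := @sum_mdeg_set _ c4 x setT [set v; w].
  rewrite cards2 nvw => H.
  have K : \sum_(y in [set: colour]) mdeg c4 x y + 2 <= 5.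
    by apply: H => z; rewrite !inE => /orP[] /eqP->; rewrite ?v4 ?w4; split => //; rewrite adjC.
  have {}K : \sum_y mdeg c4 x y + 2 <= 5.
    by apply: leq_trans K; rewrite leq_add2r; apply: eq_leq; apply: eq_bigl => y'; rewrite inE.
  by have := card_dcol_sum c4 x; move: K; clear; lia.
have ngv : ~~ adj v g.
  by apply/negP => vg; move: cg; rewrite oth4 // => -[at']; rewrite at' eqxx in ta.
have ngw2 : w2 != g.
  by apply: contra_eq_neq w24 => ->; rewrite cg; apply: contra_neq tp => -[].
have ngw : w != g by rewrite eq_sym; apply: adj_neq.
pose c5 := upd (upd c4 g (Some d)) w (Some y).
have w5 : upd c4 g (Some d) w = None by rewrite upd_other.
have v5 : c5 v = None.
  rewrite /c5 upd_other // upd_other //; apply: contra_eq_neq v4 => ->; by rewrite cg.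
have nw2w : w2 != w by rewrite eq_sym.
have w25 : c5 w2 = Some p by rewrite /c5 upd_other // upd_other.
apply: (W_final g5 v5 _ _ ta (m3 _ v5 w25)).
- by have := holes_fill y w5; rewrite (recol_holes d cg) h4 => -[].
- have nxw : x != w by rewrite eq_sym.
  have nxg : x != g by rewrite eq_sym.
  by rewrite /c5 upd_other // upd_other.
- move=> z vz nz; have [_ nzw _] := oth z vz nz; rewrite upd_other // upd_other ?oth4 //.
  by apply: contraTneq vz => ->.
Qed.

End W.

(** Three such colours would be all the colours around [x]; since [x] cannot be recoloured freely,
    one of them is repeated, the situation of [W_absurd]. *)
Lemma five_le2 x : adj v x -> #|seen c v x :\ a| <= 2.
Proof.
move=> vx; rewrite leqNgt; apply/negP => S3.
have sub : seen c v x :\ a \subset dcol c x.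
  by apply: subset_trans (seen_dcol c v x); apply: subsetDl.
have [d dS] : exists d, d \in seen c v x :\ a by apply/card_gt0P; apply: leq_trans S3.
move: (dS); rewrite in_setD1 => /andP[da ds].
have D3 : #|dcol c x| <= 3.
  rewrite leqNgt; apply/negP => d4.
  by apply: (five_rainbow vx (rainbow_card cv vx d4) da); rewrite ds.
have E1 : seen c v x :\ a = dcol c x by apply/eqP; rewrite eqEcard sub (leq_trans D3 S3).
have na : a \notin dcol c x by rewrite -E1 in_setD1 eqxx.
have E : dcol c x = seen c v x.
  by apply/esym/eqP; rewrite eqEcard seen_dcol -E1 subset_leq_card // subsetDl.
have s3 : #|seen c v x| = 3.
  by apply/eqP; rewrite -E eqn_leq D3 -E1.
have /forallPn[p] : ~~ [forall y, mdeg c x y <= 1].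
  by apply/negP => /forallP rb; apply: (five_rainbow vx rb da); rewrite ds.
rewrite -ltnNge => p2; have pD : p \in dcol c x by rewrite inE; move: p2; clear; lia.
have dp : dup c x p.
  have := mdeg_dcol cv vx pD; rewrite E s3 => p5; split; first by move: p2 p5; clear; lia.
  move=> q nq; have npq : p != q by rewrite eq_sym.
  have := sum_dcol2 c x npq; have := sum_mdeg_hole cv vx; rewrite E s3; move: p2; clear; lia.
exact: W_absurd vx E s3 na dp.
Qed.

(** Moving the hole to [x] keeps [mono] minimal, so all neighbours of [x] must then agree in colour,
    namely with the colour [y] of [v]. *)
Lemma five_shift x y : y != a -> x \in linkers c v y -> #|linkers c v y| = 2 -> seen c v x \subset [set y].
Proof.
move=> ya xk k2; have vx : adj v x by move: xk; rewrite in_linkers => /andP[].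
have cx := five_col vx; have y0 := five_absent ya.
have cr1 : crit (shift c v x y) x.
  apply: (crit_shift cr cx vx).
  - by move: k2; rewrite (cardsD1 x) xk; clear; lia.
  - by move=> z vz cz _; apply: (okcP _ _ _ (absent_okc y0)).
  - by rewrite y0.
have mo1 : mono (shift c v x y) <= M0.
  by have := shift_mono y cv cx vx; rewrite y0; move: mo; clear; lia.
have [b mb] := crit_mono5 cr1 mo1.
have yD := subsetP (seen_dcol c v x) _ (seen_linkers xk).
have := shift_mdeg_new y cv cx vx b; rewrite mb => mb'.
have yb : y = b.
  apply/eqP; case: (eqVneq y b) mb' => // nyb; rewrite addn0 => mb'.
  by have := sum_mdeg2 c x nyb; rewrite -mb'; move: yD; rewrite inE; clear; lia.
apply/subsetP => d ds; rewrite inE; apply/eqP; apply: full_seen cv vx _ ds.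
by move: mb'; rewrite yb eqxx addn1 => -[<-].
Qed.

Lemma quintuple_absurd : False.
Proof.
pose X := nb c v a.
have cX : #|X| = 5 by exact: ma.
have m1 y : y != a -> mdeg c v y <= 1 by move=> /five_absent->.
have lin y : y != a -> linkers c v y != set0.
  move=> ya; have y0 := five_absent ya.
  by case: (crit_block (y := y) opt cr); rewrite ?y0 // absent_okc.
pose P (x : G) := #|seen c v x :\ a| <= 1.
pose X' := [set x in X | P x].
pose A := ~: [set a].
pose R (y : colour) := #|linkers c v y| == 2.
pose A' := [set y in A | R y].
have nA y : y \in A -> y != a by rewrite in_setC1.
have HX x : x \in X -> adj v x by apply: nb_adj.
have sA x : seen c v x :&: A = seen c v x :\ a by rewrite setDE.
have LX y : linkers c v y \subset X by apply: linkers_class.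
have E1 : \sum_(x in X) #|seen c v x :\ a| = \sum_(y in A) #|linkers c v y|.
  transitivity (\sum_(x in X) #|seen c v x :&: A|); first by apply: eq_bigr => x _; rewrite sA.
  by rewrite double_count //; apply: eq_bigr => y _; rewrite (setIidPl (LX y)).
have sol x y : y \in A' -> x \in linkers c v y -> seen c v x \subset [set y].
  by rewrite inE => /andP[/nA ya /eqP k2] xk; apply: five_shift.
have E2 : \sum_(x in X') #|seen c v x :&: A'| = #|A'| * 2.
  rewrite double_count => [|x]; last by rewrite inE => /andP[/HX].
  rewrite -sum_nat_const; apply: eq_bigr => y yA'.
  have k2 : #|linkers c v y| = 2 by move: yA'; rewrite inE => /andP[_ /eqP].
  rewrite (setIidPl _) //; apply/subsetP => x xk.
  rewrite inE (subsetP (LX y) _ xk) /P; apply: leq_trans (eq_leq (cards1 y)); apply: subset_leq_card.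
  by apply: subset_trans (sol x y yA' xk); apply: subsetDl.
have E3 : \sum_(x in X') #|seen c v x :&: A'| <= #|X'| * 1.
  apply: leq_sum_const => x; rewrite inE => /andP[_ Px]; apply: leq_trans Px.
  by rewrite -sA; apply: subset_leq_card; apply: setIS; apply/subsetP => y; rewrite inE => /andP[].
have X5 : #|X'| <= 5 by rewrite -cX; apply: subset_leq_card; apply/subsetP => x; rewrite inE => /andP[].
have U1 : \sum_(x in X) #|seen c v x :\ a| <= #|X'| * 1 + (5 - #|X'|) * 2.
  rewrite (sum_set_split X P); apply: leq_add.
    by apply: leq_sum_const => x; rewrite inE => /andP[].
  have -> : 5 - #|X'| = #|[set x in X | ~~ P x]| by rewrite -cX (card_set_split X P) addKn.
  by apply: leq_sum_const => x; rewrite inE => /andP[/HX/five_le2].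
have L1 : #|A| * 3 <= \sum_(y in A) #|linkers c v y| + #|A'|.
  rewrite (sum_set_split A R) (card_set_split A R).
  have l1 : #|[set y in A | R y]| * 2 <= \sum_(y in [set y in A | R y]) #|linkers c v y|.
    by apply: geq_sum_const => y; rewrite inE => /andP[/nA/lin/linkers_card].
  have l2 : #|[set y in A | ~~ R y]| * 3 <= \sum_(y in [set y in A | ~~ R y]) #|linkers c v y|.
    apply: geq_sum_const => y; rewrite inE => /andP[/nA/lin/linkers_card]; rewrite /R; clear; lia.
  by move: l1 l2; rewrite /A'; clear; lia.
have cA : #|A| = 4 by rewrite cardsC1 card_ord.
(* The incidences number at least [12 - #|A'|] and at most [10 - #|X'|], yet
   [2 * #|A'| <= #|X'|]. *)
by move: E1 E2 E3 X5 U1 L1; rewrite cA; clear; lia.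
Qed.

End Five.

Lemma no_hole c v : good c -> c v = None -> holes c = h -> mono c <= M0 -> False.
Proof.
move=> gc cv hc mo; have cr : crit c v by [].
have [a ma] := crit_mono5 cr mo.
exact: quintuple_absurd cr mo ma.
Qed.

End Type56.

(** * Extremal choice and conclusion *)

Lemma nat_least (P : nat -> Prop) n : P n -> exists m, P m /\ forall k, P k -> m <= k.
Proof.
have [m] := ubnP n; elim: m n => // m IH n nm Pn.
case: (classic (exists2 k, P k & k < n)) => [[k Pk kn]|none]; first by apply: (IH k) => //; lia.
by exists n; split => // k Pk; rewrite leqNgt; apply/negP => kn; apply: none; exists k.
Qed.

Lemma total_good (G : graph5) : exists2 c : colouring G, good c & forall x, c x != None.
Proof.
(* The wholly uncoloured graph shows that a minimum exists. *)
have g0 : good ([ffun=> None] : colouring G).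
  split; last by move=> x y; rewrite ffunE.
  move=> p q [|x [|y s]] // _ _; rewrite /= hrelE !ffunE /=; by rewrite andbF.
have [h [[c1 gc1 hc1] hmin]] : exists h, (exists2 c : colouring G, good c & holes c = h) /\
    forall k, (exists2 c : colouring G, good c & holes c = k) -> h <= k.
  by apply: (@nat_least _ (holes ([ffun=> None] : colouring G))); exists [ffun=> None].
have [M0 [[c [gc hc] mc] mmin]] : exists m,
    (exists2 c : colouring G, good c /\ holes c = h & mono c = m) /\
    forall k, (exists2 c : colouring G, good c /\ holes c = h & mono c = k) -> m <= k.
  by apply: (@nat_least _ (mono c1)); exists c1.
have opt : optimal G h M0.
  by split => [c' g'|c' g' h']; [apply: hmin; exists c'|apply: mmin; exists c'].
exists c => // x; apply/negP => /eqP cx.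
by apply: (no_hole opt gc cx hc); rewrite mc.
Qed.

Theorem mainTheorem4 (T : finType) (e : rel T) :
  simple_graph e -> max_deg_le e 5 ->
  exists c : T -> 'I_5, acyclic_SD_colouring e 4 c.
Proof.
move=> [eS eI] e5; pose G := Graph5 eS eI e5.
have [c [cc ns] tot] := @total_good G.
(* The default [ord0] is never taken, because [c] has no hole. *)
pose f (x : T) : 'I_5 := odflt ord0 (c x).
have cE x : c x = Some (f x) by move: (tot x); rewrite /f; case: (c x).
have acl p q (r : rel T) : subrel r (hrel c p q) -> acyclic r.
  by move=> sub s us ss; apply: contra (cc p q s us ss); apply: sub_cycle.
exists f; split => [i|i j _]; last first.
  by apply: (acl i j) => x y; rewrite hrelE !cE.
split; first by apply: (acl i i) => x y; rewrite hrelE !cE orbb.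
move=> x; case: (eqVneq (f x) i) => [fx|nfx].
  have := ns x i; rewrite cE fx => /(_ erefl); apply: leq_trans.
  apply: subset_leq_card; apply/subsetP => y; rewrite !inE cE => /and3P[xy _ fy].
  exact/andP.
rewrite (_ : [set y | _] = set0) ?cards0 //; apply/setP => y; rewrite inE in_set0.
by apply/negP => /and3P[_ fx _]; rewrite fx in nfx.
Qed.
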